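(* Let $p$ be a prime and let $G$ be $A_n$ or $S_n$ with $n\geq \max\{6,p\}$. Then $G$ has a redundant Sylow $p$-subgroup if and only if $p=2$ and $G=A_n$, where, writing $n=\sum_{i=r}^{k}a_i2^i$ with $a_r,a_{r+1},\dots,a_k\in\{0,1\}$ and $a_r=a_k=1$, the following conditions hold: (1) if $n$ is odd, then $\sum_{i=1}^{k}a_i\equiv 1 \pmod 2$; (2) if $n$ is even, then $r\geq 2$ is even and $\sum_{i=r}^{k}a_i\equiv 1\pmod 2$.
   Context: For a finite group $G$ and a prime $p$, $G_p$ denotes the set of $p$-elements of $G$ and $\mathrm{Syl}_p(G)$ the set of Sylow $p$-subgroups of $G$. $G$ is said to have a redundant Sylow $p$-subgroup if $G_p$ is contained in the union of the members of some proper subset of $\mathrm{Syl}_p(G)$. *)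

(* Defs.v *)
From mathcomp Require Import all_boot all_fingroup all_solvable.
Set Implicit Arguments. Unset Strict Implicit. Unset Printing Implicit Defensive.
Local Open Scope group_scope.

Definition redundant_sylow (gT : finGroupType) (p : nat) (G : {group gT}) : Prop :=
  exists2 X : {set {group gT}}, X \proper 'Syl_p(G) &
    forall x, x \in G -> p.-elt x -> exists2 P, P \in X & x \in P.

Definition bdigit (n i : nat) : nat := odd (n %/ 2 ^ i).

(* Conditions (1),(2) of the theorem, with n = sum_{i=r}^k a_i 2^i,
   a_r = a_k = 1: k = trunc_log 2 n (top bit), r = logn 2 n (lowest bit). *)
Definition alt_redundant_cond (n : nat) : Prop :=
  let k := trunc_log 2 n in
  let r := logn 2 n in
  (odd n -> odd (\sum_(1 <= i < k.+1) bdigit n i)) /\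
  (~~ odd n -> [/\ 2 <= r, ~~ odd r & odd (\sum_(r <= i < k.+1) bdigit n i)]).

(* Main.v *)
Require Import Defs.
From mathcomp Require Import all_boot all_fingroup all_solvable zify.
Set Implicit Arguments. Unset Strict Implicit. Unset Printing Implicit Defensive.

(* By conjugacy, G has a redundant Sylow p-subgroup iff no p-element of G lies in
   a single Sylow p-subgroup.

   In the symmetric group, let x have a_i cycles of length p^i, where the a_i are
   the base p digits of n. A p-group A through x preserves the longest cycle,
   since its orbits have p-power size; peeling the cycles off one by one, A acts
   on each of them. On a full cycle of length p^k the center of A lies in <[x]>,
   so two p-groups through x both centralize x^(p^(k-1)), and by induction on its
   orbits they generate a p-group. Hence x lies in a single Sylow p-subgroup. For
   p = 2 and n even the same holds when the cycle of length 2^r, 2^r being the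
   lowest binary digit of n, is replaced by cycles of lengths 1, 1, 2, ...,
   2^(r-1). This settles the symmetric groups, p odd, and the alternating groups
   containing one of these two 2-elements, whose parities are given by the binary
   digit sums of n and n - 2.

   Conversely, a 2-element of the alternating group of any other cycle type has
   three fixed points or two cycles of the same length 2^j > 1, and then lies in
   two 2-subgroups whose join contains an element with an orbit of size 3. *)

(** * Binary digit sums *)

(* The digits of index at least n vanish, as n < 2 ^ n. *)
Definition dsum n := \sum_(i < n) bdigit n i.

Lemma bdigit0 n : bdigit n 0 = odd n.
Proof. by rewrite /bdigit divn1. Qed.

Lemma bdigitS n i : bdigit n i.+1 = bdigit n./2 i.
Proof. by rewrite /bdigit expnS divnMA divn2. Qed.

Lemma bdigit_small n i : n < 2 ^ i -> bdigit n i = 0.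
Proof. by move=> lt_n; rewrite /bdigit divn_small. Qed.

Lemma sum_bdigitE n N : n < 2 ^ N -> \sum_(i < N) bdigit n i = dsum n.
Proof.
have widen a b : n < 2 ^ a -> a <= b ->
    \sum_(i < b) bdigit n i = \sum_(i < a) bdigit n i.
  move=> lt_n le_ab; rewrite -!(big_mkord xpredT) (big_cat_nat (leq0n a) le_ab) //=.
  rewrite [X in _ + X]big_nat_cond [X in _ + X]big1 ?addn0 // => i /andP[/andP[le_i _] _].
  by apply/bdigit_small/(leq_trans lt_n); rewrite leq_exp2l.
move=> lt_n; rewrite /dsum -(widen N (maxn N n)) ?leq_maxl //.
by rewrite (widen n) ?leq_maxr // ltn_expl.
Qed.

Lemma dsum_half n : dsum n = odd n + dsum n./2.
Proof.
have lt_n : n < 2 ^ n.+1 by rewrite ltnW // ltn_expl.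
rewrite -(sum_bdigitE lt_n) big_ord_recl bdigit0; congr (_ + _).
rewrite -(@sum_bdigitE _ n); first by apply: eq_bigr => i _; rewrite bdigitS.
by apply: leq_ltn_trans (ltn_expl n (isT : 1 < 2)); lia.
Qed.

Lemma dsum_bitD (b : bool) n : dsum (b + n.*2) = b + dsum n.
Proof. by rewrite dsum_half half_bit_double oddD odd_double addbF; case: b. Qed.

Lemma dsum_double n : dsum n.*2 = dsum n.
Proof. exact: (dsum_bitD false). Qed.

(** A sum of distinct powers of two is its own binary expansion; this later reads digit sums off
    cycle types. *)
Lemma dsum_bits N (b : nat -> bool) :
  dsum (\sum_(i < N) b i * 2 ^ i) = \sum_(i < N) b i.
Proof.
elim: N b => [|N IHN] b; first by rewrite !big_ord0 /dsum big_ord0.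
rewrite !big_ord_recl muln1 -(IHN (b \o S)) -dsum_bitD; congr (dsum (_ + _)).
by rewrite -mul2n big_distrr; apply: eq_bigr => i _; rewrite /= expnS mulnCA.
Qed.

Lemma dsum_pow k m : m < 2 ^ k -> dsum (2 ^ k + m) = (dsum m).+1.
Proof.
elim: k m => [|k IHk] m.
  by case: m => // _; rewrite addn0 expn0 /dsum big_ord1 bdigit0 big_ord0.
rewrite -[in m < _](odd_double_half m) expnS mul2n => lt_m.
rewrite -{1}(odd_double_half m) addnCA -doubleD dsum_bitD IHk ?addnS.
  by rewrite -dsum_bitD odd_double_half.
by rewrite -ltn_double; apply: leq_ltn_trans lt_m; rewrite leq_addl.
Qed.

(** Subtracting 2 clears the lowest binary digit, at position [r.+1], and sets the [r] digits at
    positions 1 to [r]. *)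
Lemma dsum_sub2 q r : odd q -> (dsum (2 ^ r.+1 * q - 2)).+1 = dsum q + r.
Proof.
move=> odd_q; elim: r => [|r IHr].
  rewrite expn1 mul2n -(doubleB q 1) dsum_double addn0.
  rewrite [in RHS]dsum_half odd_q -{1}(odd_double_half q) odd_q addKn dsum_double.
  by rewrite add1n.
rewrite addnS -IHr; congr _.+1.
have -> : 2 ^ r.+2 * q - 2 = (true + (2 ^ r * q - 1).*2).*2.
  have : 0 < 2 ^ r * q by rewrite muln_gt0 expn_gt0 (odd_gt0 odd_q).
  by rewrite !expnS -!mulnA; move: (2 ^ r * q) => u; lia.
rewrite dsum_double dsum_bitD add1n; congr _.+1; rewrite -dsum_double.
by congr dsum; rewrite expnS -mulnA; move: (2 ^ r * q) => u; lia.
Qed.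

(** The two parities on the right are the signs of the two permutations constructed later. For odd
    [n] the sum from 1 omits the digit 1 at position 0, which flips its parity. For even [n],
    [dsum_sub2] gives [dsum (n - 2)] the parity of [dsum n + r], so [r] is even, and at least 2
    since it is positive. *)
Lemma alt_redundant_condE n : 0 < n ->
  alt_redundant_cond n <-> odd (n + dsum n) /\ (~~ odd n -> odd (dsum (n - 2))).
Proof.
move=> n_gt0; rewrite /alt_redundant_cond.
set k := trunc_log 2 n; set r := logn 2 n.
have lt_n : n < 2 ^ k.+1 by have /andP[] := trunc_log_bounds (isT : 1 < 2) n_gt0.
rewrite oddD; case: (boolP (odd n)) => odd_n /=.
  have -> : odd (\sum_(1 <= i < k.+1) bdigit n i) = ~~ odd (dsum n).
    rewrite -(sum_bdigitE lt_n) -(big_mkord xpredT (bdigit n)) [in RHS]big_ltn // bdigit0 odd_n.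
    by rewrite oddD negbK.
  by split=> [[h _]|[h _]]; split=> //; apply: h.
have r_gt0 : 0 < r by rewrite logn_gt0 mem_primes n_gt0 dvdn2.
have le_rk : r <= k.+1.
  by apply: ltnW; rewrite ltnS; apply: trunc_log_max => //; rewrite dvdn_leq ?pfactor_dvdnn.
have -> : \sum_(r <= i < k.+1) bdigit n i = dsum n.
  rewrite -(sum_bdigitE lt_n) -(big_mkord xpredT (bdigit n)) (big_cat_nat (leq0n r) le_rk) //=.
  rewrite [X in X + _]big_nat_cond [X in X + _]big1 // => i /andP[/andP[_ lt_ir] _].
  rewrite /bdigit; have /dvdnP[q ->] : 2 ^ i.+1 %| n by rewrite pfactor_dvdn.
  by rewrite expnS mulnA mulnK ?expn_gt0 // oddM andbF.
have [q odd_q def_n] : exists2 q, odd q & n = 2 ^ r.-1.+1 * q.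
  have [q co_q def_n] := pfactor_coprime (isT : prime 2) n_gt0.
  by exists q; [rewrite -coprime2n | rewrite prednK // mulnC].
have dsn : dsum n = dsum q.
  rewrite def_n; elim: (r.-1.+1) => [|m IHm]; first by rewrite mul1n.
  by rewrite expnS -mulnA mul2n dsum_double.
have ds2 : odd (dsum (n - 2)) = odd (dsum n) (+) odd r.
  have := congr1 odd (dsum_sub2 r.-1 odd_q); rewrite -def_n -dsn oddD /=.
  by rewrite -{2}(prednK r_gt0) /=; case: odd; case: odd; case: odd.
rewrite ds2; split=> [[_ /(_ isT)[_ nr ds]]|[ds /(_ isT)]].
  by rewrite ds /= (negbTE nr).
rewrite ds /= => nr; split=> // _; split=> //.
by case: (r) r_gt0 nr => [|[]].
Qed.

Local Open Scope group_scope.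

(** * Elements lying in a single Sylow subgroup *)

Section UniqueSylow.

Variables (gT : finGroupType) (p : nat).
Implicit Types (G H P Q : {group gT}) (x : gT).

Definition unique_sylow G x :=
  forall P Q, p.-Sylow(G) P -> p.-Sylow(G) Q -> x \in P -> x \in Q -> P = Q.

Lemma pelt_Sylow G x :
  x \in G -> p.-elt x -> exists2 P : {group gT}, p.-Sylow(G) P & x \in P.
Proof.
move=> Gx px; have sxG : <[x]> \subset G by rewrite cycle_subG.
have [P sylP sxP] := Sylow_superset sxG px.
by exists P => //; rewrite -cycle_subG.
Qed.

(** An omitted Sylow subgroup is a conjugate [P :^ g] of the one containing [x], and then no other
    Sylow subgroup contains [x ^ g]. *)
Lemma unique_sylow_not_redundant G x :
  x \in G -> p.-elt x -> unique_sylow G x -> ~ redundant_sylow p G.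
Proof.
move=> Gx px uniq_x [X /properP[sXS [P0]]].
rewrite inE => sylP0 nXP0 covX.
have [P sylP Px] := pelt_Sylow Gx px.
have [g Gg defP0] := Sylow_trans sylP sylP0.
have [||Q XQ Qxg] := covX (x ^ g); rewrite ?groupJ //.
  by rewrite /p_elt orderJ.
have sylQ : p.-Sylow(G) Q by move/(subsetP sXS): XQ; rewrite inE.
suffices defQ : (Q :^ g^-1)%G = P.
  case/negP: nXP0; suffices -> : P0 = Q by [].
  by apply: val_inj; rewrite /= defP0 -defQ /= conjsgKV.
apply: uniq_x => //; first by rewrite pHallJ ?groupV.
by rewrite /= mem_conjg invgK.
Qed.

(** Sylow subgroups of [H] through [x] extend to Sylow subgroups of [G] through [x], which coincide.
    Their join is thus a p-group, and by maximality both equal it. *)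
Lemma unique_sylowS G H x :
  H \subset G -> unique_sylow G x -> unique_sylow H x.
Proof.
move=> sHG uniq_x P Q sylP sylQ Px Qx.
have [P1 sylP1 sPP1] :=
  Sylow_superset (subset_trans (pHall_sub sylP) sHG) (pHall_pgroup sylP).
have [Q1 sylQ1 sQQ1] :=
  Sylow_superset (subset_trans (pHall_sub sylQ) sHG) (pHall_pgroup sylQ).
have defQ1 : P1 = Q1.
  by apply: uniq_x => //; [apply: (subsetP sPP1) | apply: (subsetP sQQ1)].
have pPQ : p.-group (P <*> Q).
  apply: pgroupS (pHall_pgroup sylP1).
  by rewrite join_subG sPP1 defQ1.
have sPQH : P <*> Q \subset H by rewrite join_subG !(pHall_sub sylP, pHall_sub sylQ).
have eP := sub_pHall sylP pPQ (joing_subl P Q) sPQH.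
have eQ := sub_pHall sylQ pPQ (joing_subr P Q) sPQH.
by apply: val_inj; rewrite -[LHS]eP.
Qed.

Lemma nonunique_redundant G :
  (forall x, x \in G -> p.-elt x -> ~ unique_sylow G x) -> redundant_sylow p G.
Proof.
move=> nuniq; have [P sylP] := Sylow_exists p G.
exists ('Syl_p(G) :\ P).
  by apply: properD1; rewrite inE.
move=> x Gx px; have [Q sylQ Qx] := pelt_Sylow Gx px.
have [R /andP[sylR /andP[Rx neqRP]]|noR] :=
  pickP (fun R : {group gT} => p.-Sylow(G) R && ((x \in R) && (R != P))).
  by exists R => //; rewrite !inE neqRP.
case: (nuniq x Gx px) => P1 Q1 sylP1 sylQ1 P1x Q1x.
have := noR P1; have := noR Q1.
by rewrite sylP1 sylQ1 P1x Q1x /= => /negbFE/eqP-> /negbFE/eqP->.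
Qed.

(** A single Sylow subgroup through [x] would contain both [A] and [B], hence the element [g], whose
    order is not a power of p. *)
Lemma nonunique_sylowP G x (A B : {group gT}) g :
    A \subset G -> B \subset G -> p.-group A -> p.-group B ->
    x \in A -> x \in B -> g \in A <*> B -> ~~ p.-elt g ->
  ~ unique_sylow G x.
Proof.
move=> sAG sBG pA pB Ax Bx gAB npg uniq_x.
have [P sylP sAP] := Sylow_superset sAG pA.
have [Q sylQ sBQ] := Sylow_superset sBG pB.
have defQ : P = Q.
  by apply: uniq_x => //; [apply: (subsetP sAP) | apply: (subsetP sBQ)].
case/negP: npg; apply: mem_p_elt (pHall_pgroup sylP) _.
by move: g gAB; apply/subsetP; rewrite join_subG sAP defQ.
Qed.

End UniqueSylow.

(** * Central elements of order p modulo the kernel of an action *)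

Section PGroupActions.

Variables (gT : finGroupType) (p : nat).
Hypothesis pr_p : prime p.
Implicit Types (T : finType) (A B : {group gT}).

Lemma exp_pgroup (G : {group gT}) :
  (forall h, h \in G -> exists m, h ^+ (p ^ m) = 1) -> p.-group G.
Proof.
move=> pG; apply/pgroupP=> q pr_q /Cauchy-/(_ pr_q)[h /pG[m hm1] oh].
have : q %| p ^ m by rewrite -oh order_dvdn hm1.
by rewrite Euclid_dvdX // => /andP[q_p _]; rewrite inE -dvdn_prime2.
Qed.

(** By Bezout the power of [x] with exponent gcd of [j] and [p ^ k.+1] is in [H]. This gcd is some
    [p ^ e], and [e <= k] would put [x ^+ (p ^ k)] in [H]. *)
Lemma expg_in_dvd (H : {group gT}) x k j :
    x ^+ (p ^ k.+1) \in H -> x ^+ (p ^ k) \notin H -> x ^+ j \in H ->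
  p ^ k.+1 %| j.
Proof.
move=> Hk1 nHk Hj; have pk0 : 0 < p ^ k.+1 by rewrite expn_gt0 prime_gt0.
have [a _ /dvdnP[b def_g]] := Bezoutl j pk0.
set g := gcdn _ _ in def_g.
have Hg : x ^+ g \in H.
  have : x ^+ (g + a * j) \in H by rewrite def_g mulnC expgM groupX.
  by rewrite expgD groupMr // mulnC expgM groupX.
have /(dvdn_pfactor _ _ pr_p)[e le_e def_ge] : g %| p ^ k.+1 by exact: dvdn_gcdl.
have [lt_ek|/eqP e_k] : e <= k \/ e == k.+1 by apply/orP; rewrite orbC -leq_eqVlt.
  case/negP: nHk; rewrite -(subnK lt_ek) addnC expnD expgM groupX //.
  by rewrite -def_ge.
by rewrite -e_k -def_ge dvdn_gcdr.
Qed.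

(** The quotient of [A] by the kernel on [S] is a nontrivial p-group, so its center has an element
    of order p; [w] is a preimage of it. *)
Lemma central_mod_astab A T (to : {action gT &-> T}) (S : {set T}) :
    p.-group A -> [acts A, on S | to] -> ~~ (A \subset 'C(S | to)) ->
  exists w, [/\ w \in A, w \notin 'C(S | to), w ^+ p \in 'C(S | to)
    & {in A & S, forall a s, to s (w * a) = to s (a * w)}].
Proof.
move=> pA nSA nCA; set C := 'C(S | to).
have nCA' : A \subset 'N(C) := subset_trans nSA (astab_norm to S).
have pAC : p.-group (A / C) := quotient_pgroup C pA.
have ntAC : A / C != 1.
  by apply: contra nCA => /eqP tr; rewrite -quotient_sub1 //= tr.
have ntZ : 'Z(A / C) != 1 by rewrite center_nil_eq1 ?(pgroup_nil pAC).
have pZ : p.-group 'Z(A / C) := pgroupS (center_sub _) pAC.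
have [_ p_dvd _] := pgroup_pdiv pZ ntZ.
have [wb Zwb owb] := Cauchy pr_p p_dvd.
have /setIP[/morphimP[w Nw Aw def_w] cwb] := Zwb.
exists w; split=> //.
- apply/negP=> Cw; move: owb (prime_gt1 pr_p).
  by rewrite def_w /= coset_id // order1 => <-.
- rewrite -/C; apply: coset_idr; first by rewrite groupX.
  by rewrite morphX //= -def_w -owb expg_order.
move=> a s Aa Ss; have Na := subsetP nCA' a Aa.
have : (w * a) * (a * w)^-1 \in C.
  apply: coset_idr; first by rewrite !(groupM, groupV).
  rewrite morphM ?(groupM, groupV) //= morphV ?groupM //= !morphM //=.
  rewrite -def_w; suffices -> : wb * coset C a = coset C a * wb by rewrite mulgV.
  by apply: (centP cwb); rewrite mem_quotient.
by move/astab_act=> /(_ s Ss) def_s; rewrite -{2}def_s -actM mulgKV.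
Qed.

End PGroupActions.

(** * Joins of p-groups sharing a long cycle *)

Section QuotientAction.

Variables (gT : finGroupType) (T : finType) (to : {action gT &-> T}).
Variables (S : {set T}) (z : gT).
Implicit Types A B K : {group gT}.

(** Commutation is required on the points of [S] only, as the groups may act in unrelated ways
    elsewhere. *)
Definition commutes_on (A : {set gT}) :=
  {in A & S, forall a s, to s (z * a) = to s (a * z)}.

Definition cycle_orbits := [set orbit to <[z]> s | s in S].

Lemma commutes_onX A : [acts A, on S | to] -> z \in 'N(S | to) ->
  commutes_on A -> forall i, {in A & S, forall a s, to s (z ^+ i * a) = to s (a * z ^+ i)}.
Proof.
move=> nSA nSz cAz i a s Aa Ss; elim: i => [|i IHi]; first by rewrite mulg1 mul1g.
rewrite expgSr -mulgA actM cAz //; last by rewrite astabs_act // groupX.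
by rewrite actM -(actM to s) IHi -actM mulgA.
Qed.

(** The elements that preserve [S] and commute with [z] there form a group. *)
Lemma commutes_on_joing A B : [acts A, on S | to] -> [acts B, on S | to] ->
  commutes_on A -> commutes_on B -> commutes_on (A <*> B).
Proof.
move=> nSA nSB cA cB.
pose C := [set a in 'N(S | to) | [forall s in S, to s (z * a) == to s (a * z)]].
have gC : group_set C.
  apply/group_setP; split=> [|a b].
    by apply/setIdP; split=> //; apply/forall_inP=> s _; rewrite mulg1 mul1g.
  move=> /setIdP[nSa /forall_inP ca] /setIdP[nSb /forall_inP cb].
  apply/setIdP; split; [by rewrite groupM | apply/forall_inP=> s Ss].
  rewrite mulgA actM (eqP (ca s Ss)) -actM -mulgA actM.
  by rewrite (eqP (cb _ _)) ?astabs_act // -actM mulgA.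
have : A <*> B \subset Group gC.
  rewrite join_subG; apply/andP; split; apply/subsetP=> a Aa; apply/setIdP; split.
  - exact: subsetP nSA a Aa.
  - by apply/forall_inP=> s Ss; apply/eqP/cA.
  - exact: subsetP nSB a Aa.
  by apply/forall_inP=> s Ss; apply/eqP/cB.
move/subsetP=> sABC a s /sABC/setIdP[_ /forall_inP ca] Ss.
exact/eqP/ca.
Qed.

Lemma setact_cycle_orbit A : [acts A, on S | to] -> z \in 'N(S | to) ->
  commutes_on A ->
  {in A & S, forall a s, to^*%act (orbit to <[z]> s) a = orbit to <[z]> (to s a)}.
Proof.
move=> nSA nSz cAz a s Aa Ss; rewrite /= setactE.
apply/setP=> t; apply/imsetP/orbitP => [[_ /orbitP[_ /cycleP[i ->] <-] ->]|].
  by exists (z ^+ i); rewrite ?mem_cycle // -!actM (commutes_onX nSA nSz).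
case=> _ /cycleP[i ->] <-; exists (to s (z ^+ i)); first by rewrite mem_orbit ?mem_cycle.
by rewrite -!actM (commutes_onX nSA nSz).
Qed.

Lemma acts_cycle_orbits A : [acts A, on S | to] -> z \in 'N(S | to) ->
  commutes_on A -> [acts A, on cycle_orbits | to^*].
Proof.
move=> nSA nSz cAz; apply/subsetP=> a Aa; rewrite !inE /=; apply/subsetP=> O.
case/imsetP=> s Ss ->; rewrite inE (setact_cycle_orbit nSA) //.
by apply: imset_f; rewrite (acts_act nSA).
Qed.

(** Lifts triviality from the quotient: an element fixing every [z]-orbit moves [s] by some power of
    [z], and as it commutes with [z] its p-th power moves [s] by a power of [z ^+ p], that is, not
    at all. *)
Lemma astab_cycle_orbits p m A h : [acts A, on S | to] -> z \in 'N(S | to) ->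
    commutes_on A -> z ^+ p \in 'C(S | to) -> h \in A ->
    h ^+ (p ^ m) \in 'C(cycle_orbits | to^*) ->
  h ^+ (p ^ m.+1) \in 'C(S | to).
Proof.
move=> nSA nSz cAz zp Ah; rewrite expnSr expgM; set g := h ^+ _ => Cg.
have Ag : g \in A by rewrite groupX.
apply/astabP=> s Ss.
have : to s g \in orbit to <[z]> s.
  have /= := astab_act Cg (imset_f (orbit to <[z]>) Ss).
  by rewrite (setact_cycle_orbit nSA) // => <-; rewrite orbit_refl.
case/orbitP=> _ /cycleP[i ->] sgi.
have sgX j : to s (g ^+ j) = to s (z ^+ (i * j)).
  elim: j => [|j IHj]; first by rewrite muln0.
  by rewrite expgS actM -sgi -actM (commutes_onX nSA) ?groupX // actM IHj -actM -expgD mulnS addnC.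
by rewrite sgX mulnC expgM; apply: (astab_act _ Ss); rewrite groupX.
Qed.

End QuotientAction.

Section FullCycle.

Variables (gT : finGroupType) (p : nat).
Hypothesis pr_p : prime p.

(* The p-group A acts on the <[x]>-orbit S with a central element of order p;
   commuting with the transitive x, it is a power of x on S, so the subgroup of
   order p of <[x]> is central on S as well. *)
Lemma cycle_power_commutes (A : {group gT}) x k (T : finType)
    (to : {action gT &-> T}) (S : {set T}) s0 :
    p.-group A -> x \in A -> S = orbit to <[x]> s0 -> [acts A, on S | to] ->
    x ^+ (p ^ k.+1) \in 'C(S | to) -> x ^+ (p ^ k) \notin 'C(S | to) ->
  commutes_on to S (x ^+ (p ^ k)) A.
Proof.
move=> pA Ax defS nSA Ck1 nCk.
have Ss0 : s0 \in S by rewrite defS orbit_refl.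
have nCA : ~~ (A \subset 'C(S | to)).
  by apply: contra nCk => /subsetP-> //; rewrite groupX.
have [w [Aw nCw Cwp cwA]] := central_mod_astab pr_p pA nSA nCA.
have SX i s : s \in S -> to s (x ^+ i) \in S.
  by move=> Ss; rewrite (acts_act nSA) ?groupX.
have fixS i : to s0 (x ^+ i) = s0 -> x ^+ i \in 'C(S | to).
  move=> fix_i; apply/astabP=> s; rewrite defS => /orbitP[_ /cycleP[j ->] <-].
  by rewrite -actM -expgD addnC expgD actM fix_i.
have : to s0 w \in S by rewrite (acts_act nSA).
rewrite {1}defS => /orbitP[_ /cycleP[i ->] s0w].
(* As [x] is transitive on [S] and commutes with [w] there, [w] is determined by its value at
   [s0]. *)
have wS : {in S, forall s, to s w = to s (x ^+ i)}.
  move=> s; rewrite {1}defS => /orbitP[_ /cycleP[j ->] <-].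
  by rewrite -actM -cwA ?groupX // actM -s0w -!actM -!expgD addnC.
have wX j : {in S, forall s, to s (w ^+ j) = to s (x ^+ (i * j))}.
  elim: j => [|j IHj] s Ss; first by rewrite muln0.
  by rewrite expgS actM wS // IHj ?SX // -actM -expgD mulnS.
have Cip : x ^+ (i * p) \in 'C[s0 | to].
  by apply/astab1P; rewrite -wX // (astab_act Cwp).
have Ck1' : x ^+ (p ^ k.+1) \in 'C[s0 | to] by apply/astab1P/(astab_act Ck1).
have nCk' : x ^+ (p ^ k) \notin 'C[s0 | to].
  by apply: contra nCk => /astab1P/fixS.
(* Since [w ^+ p] is trivial on [S], [i] is a multiple [j * p ^ k]; as [w] is not trivial, p does
   not divide [j]. *)
have : p ^ k.+1 %| i * p by apply: expg_in_dvd Cip.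
rewrite expnSr dvdn_pmul2r ?prime_gt0 // => /dvdnP[j def_i].
have co_pj : coprime p j.
  rewrite prime_coprime //; apply: contra nCw => /dvdnP[q def_j].
  apply/astabP=> s Ss; rewrite wS //.
  by rewrite def_i def_j -mulnA -expnS mulnC expgM; apply: (astab_act _ Ss); rewrite groupX.
have j_gt0 : 0 < j by case: j {def_i} co_pj => //; rewrite /coprime gcdn0 eqn_leq leqNgt prime_gt1.
(* [q] inverts [j] modulo p, which turns [x ^+ (p ^ k)] into [w ^+ q] on [S]. *)
have [b _ /dvdnP[q def_q]] := Bezoutl p j_gt0.
rewrite gcdnC (eqP co_pj) in def_q.
have zw : {in S, forall s, to s (x ^+ (p ^ k)) = to s (w ^+ q)}.
  move=> s Ss; rewrite wX // def_i mulnAC -(mulnC q) -def_q mulnDl mul1n expgD.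
  rewrite -mulnA -expnS mulnC actM; apply/esym/astab_act; last exact: SX.
  by rewrite expgM groupX.
have nSw : w \in 'N(S | to) := subsetP nSA w Aw.
move=> a s Aa Ss; rewrite (actM to s) zw // -(actM to s) (commutes_onX nSA nSw) //.
by rewrite !actM zw // (acts_act nSA).
Qed.

(* Both groups centralize, on S, the subgroup of order p of <[x]>, so one can pass
   to the orbits of the latter. *)
Lemma full_cycle_joing (A B : {group gT}) x k (T : finType)
    (to : {action gT &-> T}) (S : {set T}) s0 :
    p.-group A -> p.-group B -> x \in A -> x \in B ->
    S = orbit to <[x]> s0 -> [acts A, on S | to] -> [acts B, on S | to] ->
    x ^+ (p ^ k) \in 'C(S | to) ->
  forall h, h \in A <*> B -> exists m, h ^+ (p ^ m) \in 'C(S | to).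
Proof.
move=> pA pB Ax Bx; elim: k T to S s0 => [|k IHk] T to S s0 defS nSA nSB Ck h ABh.
  have Ss : S = [set s0].
    rewrite defS; apply/orbit1P/afixP=> _ /cycleP[i ->].
    by apply: astab_act (_ : s0 \in S); rewrite ?groupX // defS orbit_refl.
  exists 0; apply/astabP=> s; rewrite Ss => /set1P->.
  have nSh : h \in 'N(S | to).
    by move: h ABh; apply/subsetP; rewrite join_subG nSA.
  by apply/set1P; rewrite expn0 expg1 -Ss (astabs_act _ nSh) Ss set11.
have [Ck'|nCk] := boolP (x ^+ (p ^ k) \in 'C(S | to)); first exact: (IHk _ _ _ _ defS).
set z := x ^+ (p ^ k) in nCk.
have cAz : commutes_on to S z A by apply: cycle_power_commutes defS _ _ _.
have cBz : commutes_on to S z B by apply: cycle_power_commutes defS _ _ _.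
have nSx : x \in 'N(S | to) := subsetP nSA x Ax.
have nSz : z \in 'N(S | to) by rewrite groupX.
have nSAB : [acts A <*> B, on S | to] by rewrite join_subG nSA.
(* The [z]-orbits in [S] form a single [x]-orbit, on which [x ^+ (p ^ k)], being [z], is trivial:
   [k] has dropped by one. *)
have [|||//|m Cm] := IHk {set T} to^*%act (cycle_orbits to S z) (orbit to <[z]> s0) _ _ _ _ h ABh.
- have Ss0 : s0 \in S by rewrite defS orbit_refl.
  have aE i : to^*%act (orbit to <[z]> s0) (x ^+ i) = orbit to <[z]> (to s0 (x ^+ i)).
    by apply: (setact_cycle_orbit nSA) => //; rewrite groupX.
  apply/setP=> O; apply/imsetP/orbitP => [[s]|[_ /cycleP[i ->] <-]].
    rewrite {1}defS => /orbitP[_ /cycleP[i ->] <-] ->.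
    by exists (x ^+ i); rewrite ?mem_cycle.
  by exists (to s0 (x ^+ i)) => //; rewrite astabs_act ?groupX.
- exact: acts_cycle_orbits.
- exact: acts_cycle_orbits.
- apply/astabP=> _ /imsetP[s Ss ->]; rewrite (setact_cycle_orbit nSA) ?groupX //.
  by rewrite orbit_act // cycle_id.
exists m.+1; apply: (astab_cycle_orbits nSAB nSz _ _ ABh Cm).
  exact: commutes_on_joing.
by rewrite /z -expgM -expnSr.
Qed.

End FullCycle.

(** * Joins of 2-groups sharing cycles of lengths 1, 1, 2, 4, .. *)

Section Tower.

Variables (gT : finGroupType).

Section FixedSets.

Variables (T : finType) (to : {action gT &-> T}) (S : {set T}) (x : gT).

Definition fixpow i := [set s in S | to s (x ^+ (2 ^ i)) == s].

(* The cycle lengths of x on S are 1, 1, 2, 4, ..., 2^(r-1). *)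
Definition tower r :=
  #|S| = (2 ^ r)%N /\ forall i, i < r -> #|fixpow i| = (2 ^ i.+1)%N.

(** The traits of a central involution of a transitive 2-group through [x] that suffice to determine
    it on a tower. *)
Definition central_inv z :=
  [/\ z \in 'N(S | to), z ^+ 2 \in 'C(S | to),
      {in S, forall s, to s z != s} & {in S, forall s, to s (z * x) = to s (x * z)}].

Hypothesis nSx : x \in 'N(S | to).

Lemma fixpowS i : fixpow i \subset fixpow i.+1.
Proof.
apply/subsetP=> s /setIdP[Ss /eqP fs]; apply/setIdP; split=> //.
by rewrite expnSr expgM expgS actM fs expg1 fs.
Qed.

Lemma central_invX z : central_inv z ->
  forall i, {in S, forall s, to s (z * x ^+ i) = to s (x ^+ i * z)}.
Proof.
case=> nSz _ _ czx; elim=> [|i IHi] s Ss; first by rewrite mulg1 mul1g.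
rewrite expgSr mulgA actM IHi // -actM -mulgA actM czx ?astabs_act ?groupX //.
by rewrite -actM mulgA.
Qed.

Lemma fixpow_central_inv z i s : central_inv z ->
  (to s z \in fixpow i) = (s \in fixpow i).
Proof.
move=> cz; have [nSz _ _ _] := cz.
rewrite !inE (astabs_act _ nSz) /=; case Ss: (s \in S) => //=.
by rewrite -actM (central_invX cz) // actM (inj_eq (act_inj to z)).
Qed.

(** In a tower the points of period exactly [2 ^ i.+1] form one cycle of [x]. There [z] commutes
    with [x], hence is a power of it, and the only power acting as an involution without fixed
    points is [x ^+ (2 ^ i)]. *)
Lemma central_inv_fixpow z r i s : tower r -> central_inv z -> i.+1 < r ->
  s \in fixpow i.+1 -> s \notin fixpow i -> to s z = to s (x ^+ (2 ^ i)).
Proof.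
move=> [cS cF] cz lt_i Fs nFs.
have [nSz Cz2 fz _] := cz.
have Ss : s \in S by case/setIdP: Fs.
pose D := fixpow i.+1 :\: fixpow i.
have cD : #|D| = (2 ^ i.+1)%N.
  rewrite cardsD (setIidPr (fixpowS i)) !cF ?(ltnW lt_i) //.
  by rewrite [in X in X - _]expnS mul2n -addnn addnK.
have C1 : x ^+ (2 ^ i.+1) \in 'C[s | to] by apply/astab1P; case/setIdP: Fs => _ /eqP.
have nC : x ^+ (2 ^ i) \notin 'C[s | to].
  by apply: contra nFs => /astab1P fs; rewrite inE Ss fs eqxx.
pose f (j : 'I_(2 ^ i.+1)) := to s (x ^+ j).
have fD j : f j \in D.
  have nfx k : (f j \in fixpow k) = (s \in fixpow k).
    rewrite !inE /f (astabs_act _ (groupX _ nSx)); congr (_ && _).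
    by rewrite -actM -expgD addnC expgD actM (inj_eq (act_inj to _)).
  by rewrite inE !nfx nFs.
have fI : injective f.
  move=> j1 j2; wlog le_j : j1 j2 / j1 <= j2.
    by move=> wlg; case/orP: (leq_total j1 j2) => /wlg // w /esym/w.
  rewrite /f => /(congr1 (fun t => to t (x ^- j1))).
  rewrite -!actM mulgV act1 -(subnK le_j) expgD mulgK => fs.
  have : x ^+ (j2 - j1) \in 'C[s | to] by apply/astab1P.
  move/(expg_in_dvd (isT : prime 2) C1 nC)/dvdnP=> [[|q] def_j].
    by apply/val_inj/eqP; rewrite eqn_leq le_j -subn_eq0 def_j.
  have : 2 ^ i.+1 <= j2 - j1 by rewrite def_j mulSn leq_addr.
  by rewrite leqNgt (leq_ltn_trans (leq_subr _ _) (ltn_ord j2)).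
have defD : f @: setT = D.
  apply/eqP; rewrite eqEcard card_imset // cardsT card_ord cD leqnn andbT.
  by apply/subsetP=> _ /imsetP[j _ ->].
have : to s z \in D by rewrite inE !(fixpow_central_inv _ _ cz) nFs.
rewrite -defD => /imsetP[j0 _ sz]; rewrite /f in sz.
have lt_j := ltn_ord j0; set j := nat_of_ord j0 in sz lt_j.
have : x ^+ (j * 2) \in 'C[s | to].
  apply/astab1P; rewrite muln2 -addnn expgD actM -sz -actM (central_invX cz) //.
  by rewrite actM -sz -actM; apply: astab_act Ss.
move/(expg_in_dvd (isT : prime 2) C1 nC).
rewrite expnSr dvdn_pmul2r // => /dvdnP[q def_j].
have : q < 2 by move: lt_j; rewrite def_j expnS ltn_pmul2r ?expn_gt0.
case: q def_j => [|[|//]] def_j _; last by rewrite sz def_j mul1n.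
by case/eqP: (fz s Ss); rewrite sz def_j act1.
Qed.

Lemma tower_top r : tower r.+1 -> fixpow r = S.
Proof.
case=> cS cF; apply/eqP; rewrite eqEcard cF // cS leqnn andbT.
by apply/subsetP=> s /setIdP[].
Qed.

(** On cycles of length above 1 this is [central_inv_fixpow]; the two fixed points of [x] have to be
    swapped. *)
Lemma central_inv_eq z1 z2 r : tower r.+1 -> central_inv z1 -> central_inv z2 ->
  {in S, forall s, to s z1 = to s z2}.
Proof.
move=> tw cz1 cz2 s Ss.
have exF : exists i, s \in fixpow i by exists r; rewrite tower_top.
have le_r i : s \in fixpow i -> ex_minn exF <= i by case: ex_minnP => m _; apply.
have : ex_minn exF <= r by apply: le_r; rewrite tower_top.
case: ex_minnP => [[|i] Fs minF] {le_r} le_r; last first.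
  have nFs : s \notin fixpow i by apply/negP=> /minF; rewrite ltnn.
  by rewrite (central_inv_fixpow tw cz1 _ Fs) // (central_inv_fixpow tw cz2 _ Fs).
have [_ cF] := tw; have /eqP c2 := cF 0 isT.
have : #|fixpow 0 :\ s| == 1%N.
  by have := cardsD1 s (fixpow 0); rewrite (eqP c2) Fs expn1 add1n => /succn_inj <-.
case/cards1P=> t defF.
have zt z : central_inv z -> to s z = t.
  move=> cz; apply/set1P; rewrite -defF !inE; have [_ _ fz _] := cz.
  by rewrite fz //=; have := fixpow_central_inv 0 s cz; rewrite Fs inE.
by rewrite !zt.
Qed.

Lemma card_central_inv_orbits z (D : {set T}) : central_inv z -> D \subset S ->
  z \in 'N(D | to) -> #|D| = (#|[set orbit to <[z]> s | s in D]| * 2)%N.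
Proof.
move=> [nSz Cz2 fz _] sDS nDz; apply: (card_uniform_partition _ (orbit_partition _)).
  move=> _ /imsetP[s Ds ->]; have Ss := subsetP sDS s Ds.
  suffices -> : orbit to <[z]> s = [set s; to s z] by rewrite cards2 eq_sym fz.
  apply/eqP; rewrite eqEsubset; apply/andP; split; last first.
    apply/subsetP=> t /set2P[]->; first exact: orbit_refl.
    by rewrite mem_orbit ?cycle_id.
  apply/subsetP=> _ /orbitP[_ /cycleP[i ->] <-].
  rewrite -[i]odd_double_half addnC expgD -mul2n expgM actM.
  rewrite (astab_act (groupX _ Cz2)) //.
  by case: odd; rewrite ?expg1 ?expg0 ?act1 !inE eqxx ?orbT.
by rewrite cycle_subG.
Qed.

End FixedSets.

(** A central element fixing one point of a transitive set fixes them all, so the element given by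
    [central_mod_astab] has no fixed point. *)
Lemma central_inv_exists (A : {group gT}) x r (T : finType) (to : {action gT &-> T}) (S : {set T}) :
    2.-group A -> x \in A -> [transitive A, on S | to] -> #|S| = (2 ^ r.+1)%N ->
  exists z, [/\ z \in A, central_inv to S x z & commutes_on to S z A].
Proof.
move=> pA Ax trA cS; have nSA := atrans_acts trA.
have [||z [Az nCz Cz2 czA]] := central_mod_astab _ pA nSA => //.
  apply/negP=> CA; have [s0 Ss0 defS] := imsetP trA.
  have : #|S| == 1%N.
    apply/cards1P; exists s0; rewrite defS; apply/orbit1P/afixP=> a Aa.
    by apply: (astab_act (subsetP CA a Aa)).
  by rewrite cS expnS mul2n -addnn; case: (2 ^ r)%N (expn_gt0 2 r) => // n _; rewrite addnS.
exists z; split=> //; split=> //; first exact: subsetP nSA z Az.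
  move=> s Ss; apply: contra nCz => /eqP fs; apply/astabP=> t St.
  have [a Aa ->] := atransP2 trA Ss St.
  by rewrite -actM -czA // actM fs.
by move=> s Ss; apply: czA.
Qed.

(** By transitivity [A] and [B] each have a central involution on [S], and the two agree there. Both
    groups permute its orbits, on which [x] is a tower with one level less. *)
Lemma tower_joing (A B : {group gT}) x r (T : finType) (to : {action gT &-> T}) (S : {set T}) :
    2.-group A -> 2.-group B -> x \in A -> x \in B ->
    [transitive A, on S | to] -> [transitive B, on S | to] -> tower to S x r ->
  forall h, h \in A <*> B -> exists m, h ^+ (2 ^ m) \in 'C(S | to).
Proof.
move=> pA pB Ax Bx; elim: r T to S => [|r IHr] T to S trA trB tw h ABh.
  have [cS _] := tw; have [nSA nSB] := (atrans_acts trA, atrans_acts trB).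
  have nSh : h \in 'N(S | to) by move: h ABh; apply/subsetP; rewrite join_subG nSA.
  have /eqP/cards1P[s0 Ss] := cS.
  exists 0; apply/astabP=> s; rewrite Ss => /set1P->.
  by apply/set1P; rewrite expn0 expg1 -Ss (astabs_act _ nSh) Ss set11.
have [cS cF] := tw; have [nSA nSB] := (atrans_acts trA, atrans_acts trB).
have nSx := subsetP nSA x Ax.
have [z [Az cz cAz]] := central_inv_exists pA Ax trA cS.
have [z' [Bz' cz' cBz']] := central_inv_exists pB Bx trB cS.
have zz' := central_inv_eq nSx tw cz cz'.
have cBz : commutes_on to S z B.
  move=> b s Bb Ss; rewrite actM zz' // -actM cBz' // !actM zz' //.
  by rewrite (acts_act nSB).
have nSAB : [acts A <*> B, on S | to] by rewrite join_subG nSA.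
have [nSz Cz2 fz czx] := cz.
have tr_orb (C : {group gT}) : [transitive C, on S | to] ->
    commutes_on to S z C -> [transitive C, on cycle_orbits to S z | to^*].
  move=> trC cCz; have nSC := atrans_acts trC; have [s0 Ss0 defS] := imsetP trC.
  apply/imsetP; exists (orbit to <[z]> s0); first exact: imset_f.
  apply/setP=> O; apply/imsetP/orbitP => [[s]|[a Ca <-]].
    rewrite {1}defS => /orbitP[a Ca <-] ->.
    by exists a; rewrite ?(setact_cycle_orbit nSC).
  exists (to s0 a); first by rewrite (acts_act nSC).
  by rewrite (setact_cycle_orbit nSC).
have [|||m Cm] := IHr {set T} to^*%act (cycle_orbits to S z) _ _ _ h ABh.
- exact: tr_orb.
- exact: tr_orb.
- split.
    apply/eqP; rewrite -(eqn_pmul2r (isT : 0 < 2)) -(card_central_inv_orbits cz) //.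
    by rewrite cS expnSr.
  (* Passing to [z]-orbits merges the two fixed points and halves the other cycles, where [z] is the
     middle power of [x]; hence the index shifts by one. *)
  move=> i lt_ir; rewrite (_ : fixpow _ _ _ _ = [set orbit to <[z]> s | s in fixpow to S x i.+1]).
    apply/eqP; rewrite -(eqn_pmul2r (isT : 0 < 2)) -(card_central_inv_orbits cz) //.
    - by rewrite cF // expnSr.
    - by apply/subsetP=> s /setIdP[].
    by apply/astabsP=> s; apply: fixpow_central_inv.
  have aE : {in S, forall s, to^*%act (orbit to <[z]> s) (x ^+ (2 ^ i)) =
      orbit to <[z]> (to s (x ^+ (2 ^ i)))}.
    by move=> s Ss; apply: (setact_cycle_orbit nSA) => //; rewrite groupX.
  apply/setP=> O; apply/setIdP/imsetP => [[/imsetP[s Ss ->]]|[s Fs ->]].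
    rewrite aE // => /eqP/orbit_eqP/orbitP[_ /cycleP[j ->] szj]; exists s => //.
    rewrite inE Ss /= expnSr expgM expgS actM expg1 -szj -actM.
    have cx : to s (z ^+ j * x ^+ (2 ^ i)) = to s (x ^+ (2 ^ i) * z ^+ j).
      by apply: (commutes_onX nSA) => //; rewrite groupX.
    rewrite cx actM -szj -actM -expgD addnn -mul2n expgM; apply/eqP.
    by apply: (astab_act (groupX _ Cz2)).
  have Ss : s \in S by case/setIdP: Fs.
  split; first exact: imset_f.
  rewrite aE //; case Fsi: (s \in fixpow to S x i).
    by case/setIdP: Fsi => _ /eqP->.
  rewrite -(central_inv_fixpow nSx tw cz _ Fs) ?Fsi //.
  by rewrite orbit_act ?cycle_id.
exists m.+1; apply: (astab_cycle_orbits nSAB nSz _ _ ABh Cm) => //.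
exact: commutes_on_joing.
Qed.

End Tower.

(** * Permutations lying in a single Sylow subgroup *)

Lemma ltn_sub_double u v : v < 2 * u -> v - u < u.
Proof. by lia. Qed.

Lemma ltn_addl_mul a b u v : v < u -> a < b -> v + a * u < b * u.
Proof. by move=> lt_vu lt_ab; have := leq_mul lt_ab (leqnn u); lia. Qed.

Section Cycles.

Variable T : finType.
Implicit Types (S c : {set T}) (x : {perm T}).

Lemma porbit_orbit x s : porbit x s = orbit 'P <[x]> s.
Proof.
apply/setP=> t; apply/porbitP/orbitP => [[i ->]|[_ /cycleP[i ->] <-]].
  by exists (x ^+ i); rewrite ?mem_cycle.
by exists i.
Qed.

Lemma exists_subset_card S k : k <= #|S| -> exists2 c : {set T}, c \subset S & #|c| = k.
Proof.
move=> le_k; exists [set x in take k (enum S)].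
  by apply/subsetP=> x; rewrite inE => /mem_take; rewrite mem_enum.
rewrite cardsE; have /card_uniqP-> : uniq (take k (enum S)) by rewrite take_uniq ?enum_uniq.
by rewrite size_take -cardE; case: ltngtP le_k.
Qed.

Lemma exists_cycle c : 0 < #|c| -> exists x : {perm T},
  [/\ perm_on c x, {in c, forall s, porbit x s = c} & odd_perm x = ~~ odd #|c|].
Proof.
move=> c_gt0; pose f := next (enum c).
have fI : injective f := can_inj (prev_next (enum_uniq _)).
pose x := perm fI.
have xE : x =1 f by move=> s; rewrite permE.
have xout s : s \notin c -> x s = s.
  by move=> ncs; rewrite xE /f next_nth mem_enum (negbTE ncs).
have x_on : perm_on c x.
  by apply/subsetP=> s; rewrite inE; apply: contraR => /xout->.
have orb_c : {in c, forall s, porbit x s = c}.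
  move=> s cs; apply/setP=> t; apply/porbitP/idP => [[i ->]|ct].
    by elim: i => [|i IHi]; rewrite ?perm1 // expgSr permM perm_closed.
  have fst : fconnect f s t.
    by rewrite (fconnect_cycle (cycle_next (enum_uniq _))) mem_enum.
  exists (findex f s t); rewrite permX -{1}(iter_findex fst).
  by elim: (findex f s t) => //= m ->; rewrite xE.
have orb_out s : s \notin c -> porbit x s = [set s].
  move=> ncs; apply/setP=> t; rewrite inE.
  apply/porbitP/eqP => [[i ->]|->]; last by exists 0; rewrite perm1.
  by rewrite permX_fix ?xout.
exists x; split=> //.
(* The sign is the parity of [#|T|] plus the number of orbits, so the orbits are counted. *)
have def_orb : porbits x = c |: [set [set s] | s in ~: c].
  apply/setP=> O; apply/imsetP/setU1P => [[s _ ->]|].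
    have [cs|ncs] := boolP (s \in c); [left; exact: orb_c | right].
    by rewrite orb_out // imset_f // inE.
  case=> [->|/imsetP[s]].
    by have /card_gt0P[s cs] := c_gt0; exists s; rewrite ?orb_c.
  by rewrite inE => ncs ->; exists s; rewrite ?orb_out.
rewrite /odd_perm def_orb cardsU1 (card_imset _ set1_inj).
have -> : c \notin [set [set s] | s in ~: c].
  apply/imsetP=> [[s]]; rewrite inE => ncs defc.
  by case/negP: ncs; rewrite {1}defc set11.
have := cardsC c => /(congr1 odd); rewrite !oddD => <-.
by case: odd; case: odd.
Qed.

Lemma astab_expU (S1 S2 : {set T}) p (h : {perm T}) m1 m2 :
    h ^+ (p ^ m1) \in 'C(S1 | 'P) -> h ^+ (p ^ m2) \in 'C(S2 | 'P) ->
  h ^+ (p ^ (m1 + m2)) \in 'C(S1 :|: S2 | 'P).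
Proof.
move=> C1 C2; rewrite astabU inE; apply/andP; split.
  by rewrite expnD expgM groupX.
by rewrite addnC expnD expgM groupX.
Qed.

Lemma cycle_exp_astab c x s : porbit x s = c -> x ^+ #|c| \in 'C(c | 'P).
Proof.
move=> defc; apply/astabP=> t; rewrite -defc -eq_porbit_mem => /eqP <-.
by rewrite /= apermE permX iter_porbit.
Qed.

Lemma perm_on_astab c x : perm_on c x -> x \in 'C(c | 'P) -> x = 1.
Proof.
move=> on_x Cx; apply/permP=> s; rewrite perm1.
have [cs|ncs] := boolP (s \in c); last exact: out_perm on_x ncs.
by have := astab_act Cx cs.
Qed.

Lemma pelt_exp p (gT : finGroupType) (g : gT) m : prime p -> g ^+ (p ^ m) = 1 -> p.-elt g.
Proof.
move=> pr_p gm; rewrite /p_elt; apply: pnat_dvd (_ : #[g] %| p ^ m) _.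
  by rewrite order_dvdn gm.
by rewrite pnatX pnat_id.
Qed.

(* The A-orbit of s contains the p^k points of c, and its size is a power of p
   below p^(k+1). *)
Lemma acts_top_cycle p k (A : {group {perm T}}) (D c : {set T}) s :
    prime p -> p.-group A -> [acts A, on D | 'P] -> c \subset orbit 'P A s ->
    s \in c -> c \subset D -> #|c| = (p ^ k)%N -> #|D| < p ^ k.+1 ->
  [acts A, on c | 'P].
Proof.
move=> pr_p pA nDA s_cO cs sCD cc cD.
suffices -> : c = orbit 'P A s by apply: acts_orbit; apply: subsetT.
apply/eqP; rewrite eqEcard s_cO cc.
have : #|orbit 'P A s| < p ^ k.+1.
  apply: leq_ltn_trans cD; apply: subset_leq_card.
  by rewrite acts_sub_orbit // (subsetP sCD).
have /p_natP[j ->] : p.-nat #|orbit 'P A s|.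
  by rewrite card_orbit; apply: pnat_dvd pA; apply: dvdn_indexg.
by rewrite ltn_exp2l ?prime_gt1 // ltnS => le_jk; rewrite leq_exp2l ?prime_gt1.
Qed.

Lemma pelt_cycle p k c x s : prime p -> perm_on c x -> porbit x s = c ->
  #|c| = (p ^ k)%N -> p.-elt x.
Proof.
move=> pr_p x_on x_orb cc; apply: (@pelt_exp p _ _ k) => //.
apply: (perm_on_astab (c := c)); last by rewrite -cc; apply: cycle_exp_astab x_orb.
by elim: (p ^ k)%N => [|m IHm]; rewrite ?perm_on1 // expgS perm_onM.
Qed.

(* y has a_i cycles of length p^i, the a_i being the base p digits of #|S|; the
   part U is too small for its points to be in the orbit of one of these cycles. *)
Lemma exists_digit_perm p e (U S : {set T}) :
    prime p -> #|U| < p ^ e -> [disjoint U & S] -> p ^ e %| #|S| ->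
  exists y : {perm T}, [/\ perm_on S y, p.-elt y,
    p = 2 -> odd_perm y = odd (#|S| + dsum #|S|)
  & forall (x : {perm T}) (A B : {group {perm T}}), {in S, x =1 y} ->
      x \in A -> x \in B -> p.-group A -> p.-group B ->
      [acts A, on U :|: S | 'P] -> [acts B, on U :|: S | 'P] ->
    [/\ [acts A, on U | 'P], [acts B, on U | 'P]
    & forall h, h \in A <*> B -> exists m, h ^+ (p ^ m) \in 'C(S | 'P)]].
Proof.
move=> pr_p ltUe; have p_gt1 := prime_gt1 pr_p.
have [N le_N] := ubnP #|S|; elim: N S le_N => // N IHN S le_N disUS dvS.
have [->|/set0Pn[s0 Ss0]] := eqVneq S set0.
  exists 1; split=> [|||x A B _ _ _ _ _]; first exact: perm_on1.
  - by rewrite /p_elt order1.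
  - by rewrite odd_perm1 cards0 /dsum big_ord0.
  rewrite setU0 => nUA nUB; split=> // h _; exists 0.
  by apply/astabP=> s; rewrite inE.
have S_gt0 : 0 < #|S| by rewrite (cardD1 s0) Ss0.
(* The first cycle has the length of the leading power of p in [#|S|]; [e <= k] because [p ^ e]
   divides [#|S|]. *)
have [k /andP[le_kS lt_Sk] le_ek] : exists2 k, p ^ k <= #|S| < p ^ k.+1 & e <= k.
  exists (trunc_log p #|S|); first exact: trunc_log_bounds.
  by apply: trunc_log_max => //; apply: dvdn_leq.
have [c sCS cc] := exists_subset_card le_kS.
have c_gt0 : 0 < #|c| by rewrite cc expn_gt0 ltnW.
have [sg [sg_on sg_orb sg_odd]] := exists_cycle c_gt0.
have cS1 : #|S :\: c| = #|S| - p ^ k by rewrite cardsD (setIidPr sCS) cc.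
have disUc : [disjoint U & c] by apply: disjointWr sCS disUS.
have disUS1 : [disjoint U & S :\: c] by apply: disjointWr disUS; apply: subsetDl.
have [|//||y1 [y1_on py1 odd_y1 IHy1]] := IHN (S :\: c).
- by rewrite cS1; have := expn_gt0 p k; lia.
- by rewrite cS1 dvdn_sub // dvdn_exp2l.
have disc : [disjoint c & S :\: c].
  by rewrite disjoint_sym disjoint_subset; apply/subsetP=> s /setDP[].
have cy1 : commute sg y1 := perm_onC sg_on y1_on disc.
exists (sg * y1); split.
- apply: perm_onM; first exact: subset_trans sg_on sCS.
  exact: subset_trans y1_on (subsetDl _ _).
- apply: p_eltM => //; have /card_gt0P[s cs] := c_gt0.
  exact: pelt_cycle sg_on (sg_orb s cs) cc.
(* For [p = 2] the leading digit is 1, so removing [c] lowers the digit sum by exactly one. *)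
- move=> p2; have lt2 : #|S :\: c| < 2 ^ k.
    by move: lt_Sk; rewrite cS1 p2 expnS; apply: ltn_sub_double.
  have eS : #|S| = (2 ^ k + #|S :\: c|)%N by rewrite cS1 p2 subnKC // -p2.
  rewrite odd_permM sg_odd odd_y1 // cc p2 eS dsum_pow // addnS -!addnA /= !oddD.
  by case: odd; case: odd; case: odd.
move=> x A B xy Ax Bx pA pB nDA nDB.
have xS1 : {in S :\: c, x =1 y1}.
  move=> s /setDP[Ss ncs]; rewrite xy // permM; congr (y1 _).
  exact: out_perm sg_on ncs.
have xc : {in c, x =1 sg}.
  move=> s cs; rewrite xy ?(subsetP sCS) // permM.
  by apply: out_perm y1_on _; rewrite inE perm_closed // cs.
have /card_gt0P[s cs] := c_gt0.
have xXs i : (x ^+ i) s = (sg ^+ i) s /\ (sg ^+ i) s \in c.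
  elim: i => [|i [IHi1 IHi2]]; first by rewrite !perm1.
  by rewrite !expgSr !permM IHi1 xc // perm_closed.
have porb_x : porbit x s = c.
  rewrite -(sg_orb s cs); apply/setP=> t.
  by apply/porbitP/porbitP=> -[i ->]; exists i; case: (xXs i).
(* Both [#|S|] and [p ^ k.+1] are multiples of [p ^ e], so they differ by at least [p ^ e], which
   leaves room for [U]. *)
have cUS : #|U :|: S| < p ^ k.+1.
  have := leq_card_setU U S => /leq_ltn_trans; apply.
  have : p ^ e %| p ^ k.+1 by rewrite dvdn_exp2l // leqW.
  case/dvdnP=> b eb; move: dvS lt_Sk ltUe; rewrite eb => /dvdnP[a ->].
  by rewrite ltn_mul2r => /andP[pe lt_ab] ltU; exact: ltn_addl_mul.
have nc (C : {group {perm T}}) : x \in C -> p.-group C -> [acts C, on U :|: S | 'P] ->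
    [acts C, on c | 'P] /\ [acts C, on U :|: (S :\: c) | 'P].
  move=> Cx pC nDC; have ncC : [acts C, on c | 'P].
    apply: (acts_top_cycle pr_p pC nDC (s := s)) cc cUS => //.
      rewrite -porb_x; apply/subsetP=> _ /porbitP[i ->].
      by apply/orbitP; exists (x ^+ i) => //; rewrite groupX.
    exact: subset_trans sCS (subsetUr _ _).
  split=> //; have -> : U :|: (S :\: c) = (U :|: S) :\: c.
    rewrite setDUl; congr (_ :|: _); apply/esym/setDidPl.
    by rewrite -setI_eq0 setIC setI_eq0 disjoint_sym.
  exact: actsD.
have [ncA nS1A] := nc A Ax pA nDA; have [ncB nS1B] := nc B Bx pB nDB.
have [nUA nUB tameS1] := IHy1 x A B xS1 Ax Bx pA pB nS1A nS1B.
split=> // h ABh; have [m1 C1] := tameS1 h ABh.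
have orb_x : c = orbit 'P <[x]> s by rewrite -porb_x porbit_orbit.
have [|m2 C2] := full_cycle_joing pr_p pA pB Ax Bx orb_x ncA ncB (k := k) _ ABh.
  by rewrite -cc; apply: cycle_exp_astab porb_x.
exists (m1 + m2)%N; rewrite -(setID S c) (setIidPr sCS) setUC.
exact: astab_expU.
Qed.

End Cycles.

Section UniqueInSym.

Variable T : finType.
Implicit Types (S U c : {set T}) (x y : {perm T}).

Lemma card_porbit_leq x s m : 0 < m -> (x ^+ m) s = s -> #|porbit x s| <= m.
Proof.
move=> m_gt0 fix_s; pose f (j : 'I_m) := (x ^+ j) s.
have sub : porbit x s \subset f @: setT.
  apply/subsetP=> _ /porbitP[i ->]; apply/imsetP.
  exists (Ordinal (ltn_pmod i m_gt0)) => //; rewrite /f /=.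
  by rewrite {1}(divn_eq i m) expgD permM mulnC expgM (permX_fix _ fix_s).
by rewrite -(card_ord m) -cardsT; apply: leq_trans (subset_leq_card sub) (leq_imset_card _ _).
Qed.

Lemma eq_in_permX c x y : perm_on c y -> {in c, x =1 y} ->
  forall i, {in c, x ^+ i =1 y ^+ i}.
Proof.
move=> y_on xy; elim=> [|i IHi] s cs; first by rewrite !perm1.
by rewrite !expgS !permM xy // IHi ?perm_closed.
Qed.

Lemma eq_in_fixpow c x y i : perm_on c y -> {in c, x =1 y} ->
  fixpow 'P c x i = fixpow 'P c y i.
Proof.
move=> y_on xy; apply/setP=> s; rewrite !inE; case cs: (s \in c) => //=.
by rewrite !apermE (eq_in_permX y_on xy).
Qed.

Lemma eq_in_tower c x y r : perm_on c y -> {in c, x =1 y} ->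
  tower 'P c y r -> tower 'P c x r.
Proof.
by move=> y_on xy [cS cF]; split=> // i /cF; rewrite (eq_in_fixpow _ y_on xy).
Qed.

Lemma exists_cycle_2elt c r : #|c| = (2 ^ r)%N -> exists x : {perm T},
  [/\ perm_on c x, 2.-elt x, {in c, forall s, porbit x s = c} & odd_perm x = (r != 0)].
Proof.
move=> cc; have c_gt0 : 0 < #|c| by rewrite cc expn_gt0.
have [x [x_on x_orb x_odd]] := exists_cycle c_gt0.
exists x; split=> //; last by rewrite x_odd cc oddX orbF.
have /card_gt0P[s cs] := c_gt0.
exact: pelt_cycle x_on (x_orb s cs) cc.
Qed.

(** Half of [U] carries one full cycle and the other half a smaller tower. The cycles of even length
    have lengths 2, ..., [2 ^ r.-1], whence the sign. *)
Lemma exists_tower U r : #|U| = (2 ^ r)%N -> exists y : {perm T},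
  [/\ perm_on U y, 2.-elt y, odd_perm y = odd r.-1 & tower 'P U y r].
Proof.
elim: r U => [|r IHr] U cU.
  by exists 1; split; rewrite ?perm_on1 ?odd_perm1 // /p_elt order1.
have [|c sCU cc] := @exists_subset_card T U (2 ^ r).
  by rewrite cU leq_exp2l.
have cU' : #|U :\: c| = (2 ^ r)%N.
  by rewrite cardsD (setIidPr sCU) cU cc expnS mul2n -addnn addnK.
have [y' [y'_on py' odd_y' tw']] := IHr _ cU'.
have [sg [sg_on psg sg_orb odd_sg]] := exists_cycle_2elt cc.
have disc : [disjoint c & U :\: c].
  by rewrite disjoint_sym disjoint_subset; apply/subsetP=> s /setDP[].
pose y := sg * y'.
have y_c : {in c, y =1 sg}.
  move=> s cs; rewrite permM; apply: out_perm y'_on _.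
  by rewrite inE perm_closed // cs.
have y_U' : {in U :\: c, y =1 y'}.
  by move=> s /setDP[_ ncs]; rewrite permM (out_perm sg_on ncs).
exists y; split.
- apply: perm_onM; first exact: subset_trans sg_on sCU.
  exact: subset_trans y'_on (subsetDl _ _).
- by apply: p_eltM => //; apply: perm_onC sg_on y'_on disc.
- by rewrite odd_permM odd_sg odd_y'; case: (r).
split=> // i lt_ir.
have -> : fixpow 'P U y i = fixpow 'P c sg i :|: fixpow 'P (U :\: c) y' i.
  rewrite -(eq_in_fixpow i sg_on y_c) -(eq_in_fixpow i y'_on y_U').
  apply/setP=> s; rewrite !inE; case: (boolP (s \in c)) => cs /=; last by [].
  by rewrite (subsetP sCU) ?orbF.
have dis i1 : [disjoint fixpow 'P c sg i1 & fixpow 'P (U :\: c) y' i1].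
  apply: disjointWl (disjointWr _ disc); apply/subsetP=> s; first by case/setIdP.
  by case/setIdP.
rewrite cardsU (disjoint_setI0 (dis i)) cards0 subn0.
(* Below level [r] the new cycle of length [2 ^ r] contributes no fixed point; at level [r] every
   point is fixed. *)
have [lt_i|] := ltnP i r.
  have [_ ->//] := tw'; rewrite (_ : fixpow _ _ _ _ = set0) ?cards0 //.
  apply/setP=> s; rewrite !inE; apply/negP=> /andP[cs /eqP fix_s].
  have := card_porbit_leq _ fix_s; rewrite expn_gt0 sg_orb // cc => /(_ isT).
  by rewrite leq_exp2l // leqNgt lt_i.
move=> le_ri; have -> : i = r by apply/eqP; rewrite eqn_leq le_ri -ltnS lt_ir.
have -> : fixpow 'P c sg r = c.
  apply/setP=> s; rewrite inE; case cs: (s \in c) => //=.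
  by have /astabP/(_ s cs) := cycle_exp_astab (sg_orb s cs); rewrite cc => /eqP.
have -> : fixpow 'P (U :\: c) y' r = U :\: c.
  apply/eqP; rewrite eqEsubset; apply/andP; split; first by apply/subsetP=> s /setIdP[].
  case: (r) cU' tw' => [|r'] cU' tw'; last by rewrite -{1}(tower_top tw') fixpowS.
  have -> : y' = 1 by apply: (perm_on_id y'_on); rewrite cU'.
  by apply/subsetP=> s Us; rewrite inE Us expg1n act1 eqxx.
by rewrite cU' cc expnS mul2n addnn.
Qed.

(** The hypothesis makes the join of two Sylow subgroups through [x] a p-group, so they coincide by
    maximality. *)
Lemma unique_sylow_Sym p x : prime p ->
    (forall P Q : {group {perm T}}, p.-Sylow('Sym_T) P -> p.-Sylow('Sym_T) Q ->
      x \in P -> x \in Q ->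
      forall h, h \in P <*> Q -> exists m, h ^+ (p ^ m) \in 'C([set: T] | 'P)) ->
  unique_sylow p 'Sym_T%G x.
Proof.
move=> pr_p tame P Q sylP sylQ Px Qx.
have pPQ : p.-group (P <*> Q).
  apply: exp_pgroup => // h /(tame P Q sylP sylQ Px Qx)[m Cm]; exists m.
  by apply: perm_on_astab Cm; apply/subsetP=> s _; rewrite inE.
have eP := sub_pHall sylP pPQ (joing_subl P Q) (subsetT _).
have eQ := sub_pHall sylQ pPQ (joing_subr P Q) (subsetT _).
by apply: val_inj; rewrite -[LHS]eP.
Qed.

Lemma exists_unique_sylow_Sym p : prime p -> exists x : {perm T},
  [/\ p.-elt x, p = 2 -> odd_perm x = odd (#|T| + dsum #|T|)
    & unique_sylow p 'Sym_T%G x].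
Proof.
move=> pr_p; have [|||x [_ px odd_x tame_x]] := @exists_digit_perm T p 0 set0 setT pr_p.
- by rewrite cards0.
- by rewrite disjoint_subset; apply/subsetP=> s; rewrite inE.
- exact: dvd1n.
rewrite set0U cardsT in odd_x tame_x; exists x; split=> //.
apply: unique_sylow_Sym => // P Q sylP sylQ Px Qx.
have actT (A : {group {perm T}}) : [acts A, on [set: T] | 'P].
  by apply/subsetP=> a _; apply/astabsP=> s; rewrite !inE.
have [_ _] := tame_x x P Q (fun _ _ => erefl) Px Qx (pHall_pgroup sylP)
  (pHall_pgroup sylQ) (actT _) (actT _).
exact.
Qed.

(** [P] is also a Sylow subgroup of the stabilizer of [U], so it contains a conjugate of a full
    cycle on [U]. *)
Lemma Sylow2_trans U r (P : {group {perm T}}) : #|U| = (2 ^ r)%N ->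
  2.-Sylow('Sym_T) P -> [acts P, on U | 'P] -> [transitive P, on U | 'P].
Proof.
move=> cU sylP nUP; have [y [y_on py y_orb _]] := exists_cycle_2elt cU.
have sylPN : 2.-Sylow('N(U | 'P)) P := pHall_subl nUP (subsetT _) sylP.
have Ny : y \in 'N(U | 'P) by apply/astabsP=> s; rewrite /= apermE perm_closed.
have sy : <[y]> \subset 'N(U | 'P) by rewrite cycle_subG.
have [g Ng syP] := Sylow_subJ sylPN sy py.
have /card_gt0P[s0 Us0] : 0 < #|U| by rewrite cU expn_gt0.
apply/imsetP; exists s0 => //; apply/eqP; rewrite eq_sym eqEsubset.
rewrite acts_sub_orbit // Us0; apply/subsetP=> t Ut.
have gU s : (g s \in U) = (s \in U) by have := astabs_act s Ng; rewrite /= apermE.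
have /porbitP[i def_t] : g t \in porbit y (g s0) by rewrite y_orb gU.
apply/orbitP; exists ((y ^+ i) ^ g^-1).
  by rewrite -mem_conjg groupX // -cycle_subG.
by rewrite /= apermE conjgE invgK !permM -def_t permK.
Qed.

(* With 2^r the lowest binary digit of #|T|, the permutation has cycle lengths
   1, 1, 2, ..., 2^(r-1) on a set U of 2^r points, and those prescribed by the
   binary digits outside U. *)
Lemma exists_unique_sylow_Sym_even : 0 < #|T| -> ~~ odd #|T| ->
  exists x : {perm T},
  [/\ 2.-elt x, odd_perm x = odd (dsum (#|T| - 2)) & unique_sylow 2 'Sym_T%G x].
Proof.
set n := #|T| => n_gt0 even_n.
have [r [q odd_q def_n]] : exists r, exists2 q, odd q & n = (2 ^ r.+1 * q)%N.
  have r_gt0 : 0 < logn 2 n by rewrite logn_gt0 mem_primes n_gt0 dvdn2.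
  have [q co_q def_n] := pfactor_coprime (isT : prime 2) n_gt0.
  by exists (logn 2 n).-1, q; [rewrite -coprime2n | rewrite prednK // mulnC].
have [|U _ cU] := @exists_subset_card T setT (2 ^ r.+1).
  by rewrite cardsT -/n def_n leq_pmulr ?odd_gt0.
have [y [y_on py odd_y tw]] := exists_tower cU.
(* Removing [U] clears the lowest digit; what remains is divisible by [2 ^ r.+2], which exceeds
   [#|U|], so [exists_digit_perm] applies. *)
have cS : #|~: U| = (2 ^ r.+2 * q./2)%N.
  rewrite cardsCs setCK -/n def_n cU -{1}(odd_double_half q) odd_q mulnDr muln1 addKn.
  by rewrite [in RHS]expnSr -mulnA mul2n.
have disUS : [disjoint U & ~: U] by rewrite -setI_eq0 setICr.
have [||//||y' [y'_on py' odd_y' tame_y']] := @exists_digit_perm T 2 r.+2 U (~: U).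
- by [].
- by rewrite cU ltn_exp2l.
- by rewrite cS dvdn_mulr.
rewrite setUCr in tame_y'.
pose x := y * y'.
have x_U : {in U, x =1 y}.
  move=> s Us; rewrite permM; apply: out_perm y'_on _.
  by rewrite inE negbK perm_closed.
have x_S : {in ~: U, x =1 y'}.
  by move=> s; rewrite inE => nUs; rewrite permM (out_perm y_on nUs).
exists x; split.
- by apply: p_eltM => //; apply: perm_onC y_on y'_on disUS.
(* The tower has the parity of [r] and the remaining cycles that of [dsum q./2]; by [dsum_sub2]
   these add up to [dsum (#|T| - 2)]. *)
- rewrite odd_permM odd_y odd_y' // cS; have := congr1 odd (dsum_sub2 r odd_q).
  rewrite -def_n (dsum_half q) odd_q add1n addSn /= => /negb_inj->.
  have -> : dsum (2 ^ r.+2 * q./2) = dsum q./2.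
    by elim: (r.+2) => [|m IHm]; rewrite ?mul1n // expnS -mulnA mul2n dsum_double.
  by rewrite !oddD oddM oddX /= addbC.
apply: unique_sylow_Sym => // P Q sylP sylQ Px Qx h PQh.
have actT (A : {group {perm T}}) : [acts A, on [set: T] | 'P].
  by apply/subsetP=> a _; apply/astabsP=> s; rewrite !inE.
have [pP pQ] := (pHall_pgroup sylP, pHall_pgroup sylQ).
have [nUP nUQ tameS] := tame_y' x P Q x_S Px Qx pP pQ (actT _) (actT _).
have [m1 C1] := tameS h PQh.
have [m2 C2] := tower_joing pP pQ Px Qx (Sylow2_trans cU sylP nUP)
  (Sylow2_trans cU sylQ nUQ) (eq_in_tower y_on x_U tw) PQh.
exists (m2 + m1)%N; rewrite -(setUCr U); exact: astab_expU.
Qed.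

End UniqueInSym.

(** * Even permutations lying in two Sylow 2-subgroups *)

Section SwapOrbits.

Variable T : finType.
Implicit Types (R c : {set T}) (x w : {perm T}) (s t u : T).

Lemma porbit_perm1 x s : porbit x (x s) = porbit x s.
Proof. by have := porbit_perm x 1 s; rewrite expg1. Qed.

Lemma porbit_fixE x s i : ((x ^+ i) s == s) = (#|porbit x s| %| i).
Proof.
set N := #|porbit x s|; have N_gt0 : 0 < N by rewrite lt0n card_porbit_neq0.
have fixN : (x ^+ N) s = s by rewrite permX iter_porbit.
have -> : (x ^+ i) s = (x ^+ (i %% N)) s.
  by rewrite {1}(divn_eq i N) expgD permM mulnC expgM (permX_fix _ fixN).
rewrite /dvdn; case: posnP => [->|r_gt0]; first by rewrite perm1 !eqxx.
apply/negP=> /eqP/(card_porbit_leq r_gt0).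
by rewrite leqNgt ltn_pmod.
Qed.

Lemma card_porbitX2 x s m :
  #|porbit x s| = m.*2 -> #|porbit (x ^+ 2) s| = m.
Proof.
move=> cx; apply/eqP; rewrite eqn_dvd -!porbit_fixE -!expgM.
rewrite mul2n -cx permX iter_porbit eqxx /=.
have /eqP := iter_porbit (x ^+ 2) s; rewrite -permX -expgM porbit_fixE cx.
by rewrite mul2n -!muln2 dvdn_pmul2r.
Qed.

(** The parity of the exponent is well defined on a cycle of even length; it tells its two
    [x ^+ 2]-orbits apart. *)
Lemma porbit_odd_even x s m i j : #|porbit x s| = m.*2 ->
  (x ^+ i) s = (x ^+ j) s -> odd i = odd j.
Proof.
move=> cx; wlog le_ij : i j / i <= j.
  by move=> wlg; case/orP: (leq_total i j) => /wlg // w /esym/w.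
rewrite -{1}(subnK le_ij) expgD permM => /perm_inj/esym/eqP.
rewrite porbit_fixE cx => /dvdnP[q def_ji].
by rewrite -{1}(subnK le_ij) oddD def_ji oddM odd_double andbF.
Qed.

Lemma exists_pair_swap N (a b : nat -> T) :
    {in gtn N &, injective a} -> {in gtn N &, injective b} ->
    (forall i j, i < N -> j < N -> a i != b j) ->
  exists g : {perm T}, [/\ forall i, i < N -> g (a i) = b i,
    forall i, i < N -> g (b i) = a i,
    forall u, (forall i, i < N -> (u != a i) && (u != b i)) -> g u = u
  & odd_perm g = odd N].
Proof.
elim: N => [|N IHN] aI bI ab.
  by exists 1; split=> // [u _|]; rewrite ?perm1 ?odd_perm1.
have [i j lt_i lt_j|i j lt_i lt_j|i j lt_i lt_j|g [ga gb gout odd_g]] := IHN.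
- by apply: aI; apply: ltnW.
- by apply: bI; apply: ltnW.
- by apply: ab; apply: ltnW.
have neq_a i : i < N -> a N != a i.
  move=> lt_i; apply/eqP=> /(aI N i (ltnSn N) (leqW lt_i)) e.
  by rewrite -e ltnn in lt_i.
have neq_b i : i < N -> b N != b i.
  move=> lt_i; apply/eqP=> /(bI N i (ltnSn N) (leqW lt_i)) e.
  by rewrite -e ltnn in lt_i.
have neq_ab i : i < N -> a N != b i by move=> lt_i; apply: ab; rewrite // leqW.
have neq_ba i : i < N -> b N != a i by move=> lt_i; rewrite eq_sym ab // leqW.
exists (g * tperm (a N) (b N)); split.
- move=> i; rewrite permM ltnS leq_eqVlt => /predU1P[->|lt_i].
    by rewrite gout ?tpermL // => j lt_j; rewrite neq_a ?neq_ab.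
  by rewrite ga // tpermD ?neq_ab ?neq_b.
- move=> i; rewrite permM ltnS leq_eqVlt => /predU1P[->|lt_i].
    by rewrite gout ?tpermR // => j lt_j; rewrite neq_ba ?neq_b.
  by rewrite gb // tpermD ?neq_a ?neq_ba.
- move=> u uP; rewrite permM gout => [|i lt_i]; last by rewrite uP // leqW.
  by have /andP[ua ub] := uP N (leqnn _); rewrite tpermD // eq_sym.
by rewrite odd_permM odd_g odd_tperm ab //= addbT.
Qed.

(** Exchanging [(w ^+ i) s] with [(w ^+ i) t] for each [i] commutes with [w], and is a product of as
    many disjoint transpositions as the orbit has points. *)
Lemma exists_orbit_swap w s t : #|porbit w s| = #|porbit w t| ->
    t \notin porbit w s ->
  exists g : {perm T}, [/\ perm_on (porbit w s :|: porbit w t) g, commute g w,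
    g ^+ 2 = 1, g s = t & g t = s /\ odd_perm g = odd #|porbit w s|].
Proof.
move=> eq_st nst; set N := #|porbit w s| in eq_st *.
have N_gt0 : 0 < N by rewrite lt0n card_porbit_neq0.
have inj u : #|porbit w u| = N -> {in gtn N &, injective (fun i => (w ^+ i) u)}.
  move=> cu; suff inj_le i j : i <= j -> j < N -> (w ^+ i) u = (w ^+ j) u -> i = j.
    move=> i j; rewrite !inE => lt_i lt_j; case/orP: (leq_total i j) => le_ij e.
      exact: inj_le e.
    exact/esym/inj_le/esym.
  move=> le_ij lt_j; rewrite -{1}(subnK le_ij) expgD permM => /perm_inj/esym/eqP.
  rewrite porbit_fixE cu => /dvdnP[[|q] e].
    by apply/eqP; rewrite eqn_leq le_ij -subn_eq0 e.
  have : N <= j - i by rewrite e mulSn leq_addr.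
  by rewrite leqNgt (leq_ltn_trans (leq_subr _ _) lt_j).
have ab i j : (w ^+ i) s != (w ^+ j) t.
  apply: contra nst => /eqP e; rewrite -eq_porbit_mem eq_sym.
  by rewrite -(porbit_perm w i s) e porbit_perm.
have [g [gs gt gout odd_g]] := exists_pair_swap (inj s erefl) (inj t (esym eq_st))
  (fun i j _ _ => ab i j).
have modN u i : #|porbit w u| = N -> (w ^+ (i %% N)) u = (w ^+ i) u.
  move=> cu; rewrite [in RHS](divn_eq i N) expgD permM mulnC expgM -cu.
  by rewrite (permX_fix (divn _ _)) // permX iter_porbit.
have gsE i : g ((w ^+ i) s) = (w ^+ i) t.
  by rewrite -(modN s) // gs ?ltn_pmod // modN.
have gtE i : g ((w ^+ i) t) = (w ^+ i) s.
  by rewrite -(modN t) // gt ?ltn_pmod // modN.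
have gE u : u \notin porbit w s :|: porbit w t -> g u = u.
  rewrite inE negb_or => /andP[nus nut]; apply: gout => i _.
  apply/andP; split; [apply: contra nus | apply: contra nut] => /eqP->;
  exact: mem_porbit.
have orbS u : (w u \in porbit w s :|: porbit w t) = (u \in porbit w s :|: porbit w t).
  by rewrite !inE -!eq_porbit_mem porbit_perm1.
exists g; split.
- by apply/subsetP=> u; rewrite inE; apply: contraR => /gE->.
- apply/permP=> u; rewrite !permM.
  have [|nu] := boolP (u \in porbit w s :|: porbit w t); last by rewrite !gE ?orbS.
  have wS v i : w ((w ^+ i) v) = (w ^+ i.+1) v by rewrite expgSr permM.
  by case/setUP=> /porbitP[i ->]; rewrite ?(gsE, gtE) !wS ?(gsE, gtE).
- apply/permP=> u; rewrite expgS expg1 permM perm1.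
  have [|nu] := boolP (u \in porbit w s :|: porbit w t); last by rewrite !gE.
  by case/setUP=> /porbitP[i ->]; rewrite ?(gsE, gtE).
- by have := gsE 0; rewrite !perm1.
by have := gtE 0; rewrite !perm1.
Qed.

End SwapOrbits.

Section NonUnique.

(** The commuting elements [a] and [a ^ x] generate a 2-group; [x] swaps them because [x ^+ 2]
    centralizes [a], so it normalizes that group. *)
Lemma pgroup_involution_gen (gT : finGroupType) (x a : gT) :
    2.-elt x -> a ^+ 2 = 1 -> commute a (x ^+ 2) -> commute a (a ^ x) ->
  2.-group <<[set x; a]>>.
Proof.
move=> px a2 cax caa.
have pa b : b ^+ 2 = 1 -> 2.-group <[b : gT]> by move=> b2; apply: (@pelt_exp 2 _ b 1).
have pE : 2.-group (<[a]> <*> <[a ^ x]>).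
  have cE : <[a ^ x]> \subset 'C(<[a]>) 
    by rewrite cycle_subG; apply/centP=> _ /cycleP[i ->]; apply/commuteX/commute_sym.
  by rewrite (cent_joinEr cE) pgroupM !pa // -conjXg a2 conj1g.
have nEx : <[x]> \subset 'N(<[a]> <*> <[a ^ x]>).
  rewrite cycle_subG inE sub_conjg join_subG !cycle_subG !mem_conjgV; apply/andP; split.
    by rewrite mem_gen // inE cycle_id orbT.
  by rewrite -conjgM -[x * x]/(x ^+ 2) conjgE cax mulKg mem_gen // inE cycle_id.
apply: pgroupS (_ : 2.-group ((<[a]> <*> <[a ^ x]>) <*> <[x]>)).
  rewrite gen_subG; apply/subsetP=> b /set2P[]->; rewrite mem_gen // inE ?cycle_id ?orbT //.
  by rewrite mem_gen // inE cycle_id.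
by rewrite (norm_joinEr nEx) pgroupM pE.
Qed.

Variable T : finType.
Implicit Types (R : {set T}) (c x y : {perm T}) (s t u v z : T).

Lemma not_2elt_3cycle (g : {perm T}) s : (g ^+ 3) s = s -> g s != s -> ~~ 2.-elt g.
Proof.
move=> g3 gs; apply: contra gs => /p_natP[m og].
have : #|porbit g s| %| gcdn 3 (2 ^ m).
  rewrite dvdn_gcd -!porbit_fixE g3 eqxx /=.
  by rewrite -og expg_order perm1.
rewrite (eqP (_ : coprime 3 (2 ^ m))) ?coprimeXr // => /(dvdn_trans)/(_ (dvdnn 1)).
by rewrite -porbit_fixE expg1.
Qed.

(* If needed, the parity of a and b is corrected by a transposition, outside R,
   of a Sylow 2-subgroup of the pointwise stabilizer of R. *)
Lemma nonunique_sylow_Alt x R (a b : {perm T}) s :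
    x \in 'Alt_T -> 2.-elt x -> x \in 'N(R | 'P) -> perm_on R a -> perm_on R b ->
    2.-group <<[set x; a]>> -> 2.-group <<[set x; b]>> ->
    odd_perm a || odd_perm b ==> (1 < #|~: R|) ->
    s \in R -> ((a * b) ^+ 3) s = s -> (a * b) s != s ->
  ~ unique_sylow 2 'Alt_T%G x.
Proof.
move=> Ax px nRx a_on b_on pxa pxb parity Rs ab3 abs.
set rs := restr_perm R.
(* The part of [x] outside [R]; the chosen Sylow subgroup [P] of the pointwise stabilizer contains
   it. *)
pose x' := x * (rs x)^-1.
have onN c : perm_on R c -> c \in 'N(R | 'P).
  by move=> c_on; apply/astabsP=> u; rewrite /= apermE perm_closed.
have restr_id c : perm_on R c -> rs c = c.
  move=> c_on; apply/permP=> u; have [Ru|nRu] := boolP (u \in R).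
    by rewrite restr_permE ?onN.
  by rewrite (out_perm (restr_perm_on _ _) nRu) (out_perm c_on nRu).
have Cx' : x' \in 'C(R | 'P).
  apply/astabP=> u Ru; rewrite /= apermE permM.
  by rewrite -(restr_permE nRx Ru) permK.
have px' : 2.-elt x'.
  have prs : 2.-elt (rs x) by apply: morph_p_elt.
  by apply: p_eltM; rewrite ?p_eltV //; apply/commuteV/commute_sym/restr_perm_commute.
have [P sylP Px'] := pelt_Sylow Cx' px'.
have CP : P \subset 'C(R | 'P) := pHall_sub sylP.
have cC (g h : {perm T}) : perm_on R g -> h \in 'C(R | 'P) -> commute g h.
  move=> g_on Ch; apply: perm_onC (~: R) _ _ g_on _ _; last by rewrite -setI_eq0 setICr.
  apply/subsetP=> u; rewrite !inE; apply: contra => Ru.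
  by have := astab_act Ch Ru; rewrite /= apermE => ->.
have yP c : odd_perm c ==> (1 < #|~: R|) -> exists2 y, y \in P & odd_perm y = odd_perm c.
  case: (odd_perm c) => [/= /card_gt1P[u [v [nRu nRv neq_uv]]]|_]; last first.
    by exists 1; rewrite ?group1 ?odd_perm1.
  have Cuv : tperm u v \in 'C(R | 'P).
    apply/astabP=> z Rz; rewrite /= apermE tpermD //; apply/eqP=> e.
      by move: nRu; rewrite inE e Rz.
    by move: nRv; rewrite inE e Rz.
  have puv : 2.-elt (tperm u v).
    by apply: (@pelt_exp 2 _ _ 1) => //; rewrite expgS expg1 tperm2.
  have scuv : <[tperm u v]> \subset 'C(R | 'P) by rewrite cycle_subG.
  have [g _] := Sylow_subJ sylP scuv puv; rewrite cycle_subG => Puv.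
  exists (tperm u v ^ g^-1); first by rewrite -mem_conjg.
  by rewrite odd_permJ odd_tperm neq_uv.
(* Both [x] and [c * y] lie in the product of [P] with the restriction [L] of the group to [R]; the
   two factors are commuting 2-groups. *)
have pL c y : perm_on R c -> 2.-group <<[set x; c]>> -> y \in P ->
    2.-group <<[set x; c * y]>>.
  move=> c_on pxc Py; set L := rs @* <<[set x; c]>>.
  have sN : <<[set x; c]>> \subset 'N(R | 'P).
    by rewrite gen_subG; apply/subsetP=> d /set2P[]->; [|apply: onN].
  have pL : 2.-group L by apply: morphim_pgroup.
  have cLP : P \subset 'C(L).
    rewrite centsC; apply/subsetP=> _ /morphimP[z Nz _ ->].
    by apply/centP=> h Ph; apply: cC; rewrite ?restr_perm_on ?(subsetP CP).
  have memL d : d \in [set x; c] -> rs d \in L.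
    by move=> xz; apply: mem_morphim; [apply: (subsetP sN) |]; rewrite mem_gen.
  apply: pgroupS (_ : 2.-group (L <*> P)); last first.
    by rewrite (cent_joinEr cLP) pgroupM pL (pHall_pgroup sylP).
  have sLP : L \subset L <*> P := joing_subl _ _.
  have sPL : P \subset L <*> P := joing_subr _ _.
  rewrite gen_subG; apply/subsetP=> z /set2P[]->.
    rewrite -{1}(mulgKV (rs x) x); apply: groupM; first exact: (subsetP sPL).
    by apply: (subsetP sLP); rewrite memL ?set21.
  apply: groupM; last exact: (subsetP sPL).
  by apply: (subsetP sLP); rewrite -{1}(restr_id c c_on) memL ?set22.
have [|y1 Py1 odd1] := yP a; first by apply/implyP=> odd_a; rewrite odd_a in parity.
have [|y2 Py2 odd2] := yP b.
  by apply/implyP=> odd_b; rewrite odd_b orbT in parity.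
have sAlt c y : odd_perm y = odd_perm c -> <<[set x; c * y]>> \subset 'Alt_T.
  move=> e; rewrite gen_subG; apply/subsetP=> z /set2P[]-> //.
  by rewrite Alt_even odd_permM e addbb.
(* The corrections by [y1] and [y2] are invisible on [R], so [g] keeps the orbit of size 3 of
   [a * b]. *)
pose g := (a * y1) * (b * y2).
have gR u : u \in R -> g u = (a * b) u /\ g u \in R.
  have yR y v : y \in P -> v \in R -> y v = v.
    by move=> /(subsetP CP) Cy Rv; have := astab_act Cy Rv.
  move=> Ru; rewrite !permM; have Ra : a u \in R by rewrite perm_closed.
  by rewrite (yR y1) // (yR y2) ?perm_closed.
have g3 : (g ^+ 3) s = s.
  have [e1 R1] := gR s Rs; have [e2 R2] := gR _ R1; have [e3 R3] := gR _ R2.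
  by move: ab3; rewrite !permX /= e3 e2 e1.
have gs : g s != s by case: (gR s Rs) => ->.
apply: (@nonunique_sylowP _ 2 _ x <<[set x; a * y1]>> <<[set x; b * y2]>> g).
- exact: sAlt.
- exact: sAlt.
- exact: pL.
- exact: pL.
- by rewrite mem_gen ?set21.
- by rewrite mem_gen ?set21.
- rewrite groupM // mem_gen // inE; first by rewrite mem_gen ?set22.
  by rewrite orbC mem_gen ?set22.
exact: not_2elt_3cycle g3 gs.
Qed.

(** The transpositions of [u, v] and of [v, w] commute with [x] and their product is a 3-cycle;
    being odd, they need two further points for the parity correction. *)
Lemma fix3_nonunique x u v w : 5 <= #|T| -> x \in 'Alt_T -> 2.-elt x ->
    u != v -> v != w -> u != w -> x u = u -> x v = v -> x w = w ->
  ~ unique_sylow 2 'Alt_T%G x.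
Proof.
move=> n5 Ax px uv vw uw xu xv xw; set R := [set u; v; w].
have xR z : z \in R -> x z = z by rewrite !inE => /orP[/orP[]|] /eqP->.
have Cx : x \in 'C(R | 'P) by apply/astabP=> z /xR.
have cx c : perm_on R c -> commute c x.
  move=> c_on; apply: (perm_onC c_on (_ : perm_on (~: R) x)).
    by apply/subsetP=> z; rewrite !inE; apply: contra => Rz; rewrite xR ?inE.
  by rewrite -setI_eq0 setICr.
have onR z1 z2 : z1 \in R -> z2 \in R -> perm_on R (tperm z1 z2).
  move=> R1 R2; apply: subset_trans (tperm_on z1 z2) _.
  by apply/subsetP=> z /set2P[]->.
have pR c : perm_on R c -> c ^+ 2 = 1 -> 2.-group <<[set x; c]>>.
  move=> c_on c2; have cxc := cx c c_on; apply: pgroup_involution_gen => //.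
    exact: commuteX.
  by rewrite conjgE cxc mulKg.
have Ru : u \in R by rewrite !inE eqxx.
have Rv : v \in R by rewrite !inE eqxx orbT.
have Rw : w \in R by rewrite !inE eqxx !orbT.
have t2 z1 z2 : tperm z1 z2 ^+ 2 = 1 :> {perm T} by rewrite expgS expg1 tperm2.
have abu : (tperm u v * tperm v w) u = w by rewrite permM tpermL tpermL.
have abw : (tperm u v * tperm v w) w = v by rewrite permM (@tpermD _ u v w) // tpermR.
have abv : (tperm u v * tperm v w) v = u by rewrite permM tpermR (@tpermD _ v w u) // eq_sym.
apply: (nonunique_sylow_Alt Ax px (R := R) (a := tperm u v) (b := tperm v w) (s := u)) => //.
- exact: subsetP (astab_sub _ _) _ Cx.
- exact: onR.
- exact: onR.
- by apply: pR; rewrite ?onR.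
- by apply: pR; rewrite ?onR.
- apply/implyP=> _; have := cardsC R; rewrite -(ltn_add2l #|R|) => ->.
  by apply: leq_ltn_trans n5; rewrite addn1 ltnS /R -setUA cardsU1 cards2;
    case: (_ \notin _); case: (_ != _).
- by rewrite permX /= abu abw abv.
by rewrite abu eq_sym.
Qed.

(* On the four orbits A0, A1 = x A0, B0, B1 = x B0 of x^2, the involution a swaps
   A0 with B0 and b swaps A0 with B1. *)
Lemma two_cycles_nonunique x s t m : 6 <= #|T| -> x \in 'Alt_T -> 2.-elt x ->
    #|porbit x s| = (2 ^ m.+1)%N -> #|porbit x t| = (2 ^ m.+1)%N ->
    t \notin porbit x s ->
  ~ unique_sylow 2 'Alt_T%G x.
Proof.
move=> n6 Ax px cs ct nst; rewrite expnS mul2n in cs ct.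
set R := porbit x s :|: porbit x t.
have xR u : (x u \in R) = (u \in R).
  by rewrite !inE -!eq_porbit_mem porbit_perm1.
have nRx : x \in 'N(R | 'P) by apply/astabsP=> u; rewrite /= apermE xR.
have sub2 u : porbit (x ^+ 2) u \subset porbit x u.
  by apply/subsetP=> _ /porbitP[i ->]; rewrite -expgM mem_porbit.
(* Applied with [t' = t] and [t' = x t]. The conjugate [a ^ x] commutes with [a], as it moves only
   points in the other two orbits of [x ^+ 2]. *)
have swapP t' : #|porbit x t'| = (2 ^ m).*2 -> porbit x t' = porbit x t ->
  exists a : {perm T}, [/\ perm_on R a, 2.-group <<[set x; a]>>,
    odd_perm a = (m == 0), a s = t' & a t' = s /\
    forall u, u \notin porbit (x ^+ 2) s :|: porbit (x ^+ 2) t' -> a u = u].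
  move=> ct' eqt; have nst' : t' \notin porbit x s.
    by rewrite -eq_porbit_mem eqt eq_porbit_mem.
  have c2s := card_porbitX2 cs; have c2t := card_porbitX2 ct'.
  have [|a [a_on cax a2 a_s [a_t odd_a]]] := exists_orbit_swap (etrans c2s (esym c2t)).
    by apply: contra nst'; apply: (subsetP (sub2 s)).
  exists a; split=> //; last by split=> // u nu; apply: out_perm a_on nu.
  - apply: subset_trans a_on _; rewrite /R -eqt.
    by apply: setUSS; apply: sub2.
  - apply: pgroup_involution_gen => //; set c := _ :|: _ in a_on.
    have axon : perm_on (x @: c) (a ^ x).
      apply/subsetP=> u; rewrite inE -{1}(permKV x u) permJ => axu.
      rewrite -(permKV x u); apply: imset_f; apply: (subsetP a_on); rewrite inE.
      by apply: contra axu => /eqP->; rewrite permKV.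
    apply: perm_onC a_on axon _; rewrite disjoint_sym disjoint_subset.
    apply/subsetP=> _ /imsetP[u cu ->]; rewrite inE.
    have st i j : (x ^+ i) s != (x ^+ j) t'.
      apply: contra nst' => /eqP e; rewrite -eq_porbit_mem eq_sym.
      by rewrite -(porbit_perm x i s) e porbit_perm.
    have xE2 i v : x (((x ^+ 2) ^+ i) v) = (x ^+ (2 * i).+1) v.
      by rewrite -expgM expgSr permM.
    apply/negP; case/setUP: cu => /porbitP[i ->]; rewrite xE2;
      case/setUP=> /porbitP[j]; rewrite -expgM.
    + by move/(porbit_odd_even cs); rewrite /= !oddM.
    + by move/eqP; rewrite (negbTE (st _ _)).
    + by move/esym/eqP; rewrite (negbTE (st _ _)).
    by move/(porbit_odd_even ct'); rewrite /= !oddM.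
  by rewrite odd_a c2s oddX orbF.
have [||a [a_on pa odd_a a_s [a_t a_out]]] := swapP t => //.
have eqxt : porbit x (x t) = porbit x t by rewrite porbit_perm1.
have [||b [b_on pb odd_b b_s [b_t b_out]]] := swapP (x t) => //.
  by rewrite eqxt.
have nin u : u \in porbit x t -> u \notin porbit (x ^+ 2) s.
  move=> ut; apply: contra nst => /(subsetP (sub2 s)).
  by rewrite -!eq_porbit_mem => /eqP <-; rewrite eq_sym eq_porbit_mem.
(* The product runs through [s], [t], [x t] and back to [s]. *)
have ab_s : (a * b) s = t.
  rewrite permM a_s b_out // inE negb_or nin ?porbit_id //=.
  apply/porbitP=> [[i]]; rewrite -expgM -permM -expgS => e.
  by have := porbit_odd_even (i := 0) ct (etrans (perm1 t) e); rewrite /= oddM.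
have ab_t : (a * b) t = x t by rewrite permM a_t.
have ab_xt : (a * b) (x t) = s.
  rewrite permM a_out ?b_t // inE negb_or nin /=; last by rewrite -eqxt porbit_id.
  apply/porbitP=> [[i]]; rewrite -expgM -[in x t](expg1 x) => /(porbit_odd_even ct).
  by rewrite /= oddM.
apply: (nonunique_sylow_Alt Ax px nRx a_on b_on pa pb (s := s)).
(* The swaps are odd only when [m = 0]; then [R] has four points, and two others remain. *)
- rewrite odd_a odd_b orbb; apply/implyP=> /eqP m0.
  have := cardsC R; rewrite -(ltn_add2l #|R|) => ->.
  apply: leq_ltn_trans n6; rewrite addn1 ltnS.
  by apply: leq_trans (leq_card_setU _ _) _; rewrite cs ct m0.
- by rewrite inE porbit_id.
- by rewrite permX /= ab_s ab_t ab_xt.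
by rewrite ab_s; apply: contra nst => /eqP->; rewrite porbit_id.
Qed.

End NonUnique.

(** * Sign of a 2-element with few repeated cycle lengths *)

Section OrbitCounts.

Variables (T : finType) (x : {perm T}).
Hypothesis px : 2.-elt x.

Definition orbit_count i := #|[set c in porbits x | #|c| == (2 ^ i)%N]|.

Lemma card_porbit_2elt c :
  c \in porbits x -> exists2 i, i < #|T|.+1 & #|c| = (2 ^ i)%N.
Proof.
case/imsetP=> s _ ->; have /p_natP[i ci] : 2.-nat #|porbit x s|.
  by rewrite porbit_orbit card_orbit; apply: pnat_dvd px; apply: dvdn_indexg.
exists i => //; rewrite ltnS; apply: leq_trans (ltnW (ltn_expl i (isT : 1 < 2))) _.
by rewrite -ci max_card.
Qed.

Lemma sum_porbits (F : nat -> nat) :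
  \sum_(c in porbits x) F #|c| = \sum_(i < #|T|.+1) orbit_count i * F (2 ^ i)%N.
Proof.
rewrite (partition_big (fun c : {set T} => inord (logn 2 #|c|) : 'I_#|T|.+1) xpredT) //=.
apply: eq_bigr => i _; rewrite /orbit_count -sum_nat_const.
have eqP2 c : (c \in porbits x) && (inord (logn 2 #|c|) == i) =
    (c \in [set c in porbits x | #|c| == (2 ^ i)%N]).
  rewrite inE; case Oc: (c \in porbits x) => //=.
  have [k lt_k ->] := card_porbit_2elt Oc; rewrite pfactorK // eqn_exp2l //.
  by rewrite -val_eqE /= inordK.
by apply: eq_big => [c|c]; rewrite eqP2 // inE => /andP[_ /eqP->].
Qed.

Lemma card_porbits : #|porbits x| = \sum_(i < #|T|.+1) orbit_count i.
Proof.
rewrite -sum1_card (sum_porbits (fun _ => 1%N)).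
by apply: eq_bigr => i _; rewrite muln1.
Qed.

Lemma card_sum_orbit_count : #|T| = \sum_(i < #|T|.+1) orbit_count i * 2 ^ i.
Proof.
rewrite -[LHS]cardsT -(sum_porbits id); apply: card_partition.
have -> : porbits x = [set orbit 'P <[x]> s | s in [set: T]].
  apply/setP=> c; apply/imsetP/imsetP=> -[s _ ->]; exists s; rewrite ?inE //.
    exact: porbit_orbit.
  exact/esym/porbit_orbit.
by apply: orbit_partition; apply/subsetP=> a _; apply/astabsP=> s; rewrite !inE.
Qed.

Lemma orbit_count_bits : (forall i, orbit_count i.+1 <= 1) ->
  #|T| = (orbit_count 0 + \sum_(i < #|T|) (orbit_count i.+1 == 1%N) * 2 ^ i.+1)%N /\
  #|porbits x| = (orbit_count 0 + \sum_(i < #|T|) (orbit_count i.+1 == 1%N))%N.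
Proof.
move=> le1; have bE i : orbit_count i.+1 = (orbit_count i.+1 == 1%N).
  by have := le1 i; case: orbit_count => [|[]].
split; [rewrite {1}card_sum_orbit_count | rewrite card_porbits];
  rewrite big_ord_recl ?muln1; congr (_ + _); apply: eq_bigr => i _;
  by rewrite !lift0 {1}bE.
Qed.

(** With distinct cycle lengths the multiplicities are the binary digits of [#|T|], so the number of
    cycles is the digit sum. *)
Lemma orbit_count_small_parity : (forall i, orbit_count i.+1 <= 1) -> orbit_count 0 <= 1 ->
  odd_perm x = odd (#|T| + dsum #|T|).
Proof.
move=> le1 le01; have [cT cO] := orbit_count_bits le1.
rewrite oddD /odd_perm cO; congr (_ (+) odd _).
pose b i := orbit_count i == 1%N.
have -> : orbit_count 0 = b 0 by rewrite /b; case: orbit_count le01 => [|[]].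
rewrite -[RHS](_ : \sum_(i < #|T|.+1) b i = _); first by rewrite big_ord_recl.
rewrite -dsum_bits big_ord_recl muln1 [in RHS]cT; congr (dsum (_ + _)).
by rewrite /b; case: orbit_count le01 => [|[]].
Qed.

(** Without the two fixed points, the cycle lengths are distinct powers of two above 1, which are
    the binary digits of [#|T| - 2]. *)
Lemma orbit_count_two_parity : (forall i, orbit_count i.+1 <= 1) -> orbit_count 0 = 2 ->
  ~~ odd #|T| /\ odd_perm x = odd (dsum (#|T| - 2)).
Proof.
move=> le1 b0; have [cT cO] := orbit_count_bits le1.
pose b i := (0 < i) && (orbit_count i == 1%N).
have cT2 : #|T| = (2 + \sum_(i < #|T|.+1) b i * 2 ^ i)%N.
  by rewrite [LHS]cT b0 big_ord_recl mul0n add0n.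
have even_n : ~~ odd #|T|.
  rewrite cT2 oddD /= big_ord_recl mul0n add0n.
  by elim/big_ind: _ => // [u v ou ov|i _]; rewrite ?oddD ?(negbTE ou) // oddM oddX andbF.
split=> //; rewrite /odd_perm (negbTE even_n) cO b0 oddD /=; congr odd.
by rewrite [in X in _ = dsum X]cT2 addKn dsum_bits big_ord_recl add0n.
Qed.

End OrbitCounts.

(** Uniqueness leaves at most one cycle of each length above 1 and at most two fixed points; the
    digit conditions then force [x] to be odd. *)
Lemma Alt_nonunique_sylow (T : finType) (x : {perm T}) : 6 <= #|T| ->
    odd (#|T| + dsum #|T|) -> (~~ odd #|T| -> odd (dsum (#|T| - 2))) ->
    x \in 'Alt_T -> 2.-elt x ->
  ~ unique_sylow 2 'Alt_T%G x.
Proof.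
move=> n6 cond1 cond2 Ax px uniq_x.
have even_x : odd_perm x = false by apply/negbTE; rewrite -Alt_even.
have fix1 u : #|porbit x u| == (2 ^ 0)%N -> x u = u.
  by move/eqP=> cu; apply/eqP; rewrite -{1}[x]expg1 porbit_fixE cu.
have le1 i : orbit_count x i.+1 <= 1.
  rewrite leqNgt; apply/negP=> /card_gt1P[c1 [c2 []]].
  case/setIdP=> /imsetP[s _ ->] /eqP cs /setIdP[/imsetP[t _ ->] /eqP ct] neq.
  apply: (two_cycles_nonunique n6 Ax px cs ct) uniq_x.
  by apply: contra neq; rewrite -eq_porbit_mem eq_sym.
have : orbit_count x 0 <= 2.
  rewrite leqNgt; apply/negP=> /card_gt2P[c1 [c2 [c3 [[]]]]].
  case/setIdP=> /imsetP[u _ ->] /fix1 xu /setIdP[/imsetP[v _ ->] /fix1 xv].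
  case/setIdP=> /imsetP[w _ ->] /fix1 xw [nuv nvw nwu].
  have neq u1 v1 : porbit x u1 != porbit x v1 -> u1 != v1 by apply: contra => /eqP->.
  apply: (fix3_nonunique (ltnW n6) Ax px _ _ _ xu xv xw) uniq_x; try exact: neq.
  by rewrite eq_sym neq.
rewrite leq_eqVlt ltnS => /predU1P[b2|b1].
  have [even_n ox] := orbit_count_two_parity px le1 b2.
  by have := cond2 even_n; rewrite -ox even_x.
by have := orbit_count_small_parity px le1 b1; rewrite cond1 even_x.
Qed.

(** * Elements of odd order, and the equivalence *)

Lemma odd_order_even_perm (T : finType) (x : {perm T}) : odd #[x] -> ~~ odd_perm x.
Proof.
have oddX k : odd_perm (x ^+ k) = odd k && odd_perm x.
  elim: k => [|k IHk]; first by rewrite odd_perm1.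
  by rewrite expgS odd_permM IHk /=; case: odd; case: odd_perm.
by move=> odd_o; have := oddX #[x]; rewrite expg_order odd_perm1 odd_o /= => <-.
Qed.

Theorem theoremB (p n : nat) (G : {group {perm 'I_n}}) :
  prime p -> 6 <= n -> p <= n ->
  G = ('Alt_('I_n))%G \/ G = ('Sym_('I_n))%G ->
  (redundant_sylow p G <->
     [/\ p = 2, G = ('Alt_('I_n))%G & alt_redundant_cond n]).
Proof.
move=> pr_p n6 _ defG; have n_gt0 : 0 < n by apply: leq_trans n6.
have cardT := card_ord n.
split=> [redG|[-> -> /alt_redundant_condE-/(_ n_gt0)[cond1 cond2]]]; last first.
  apply: nonunique_redundant => x Ax px.
  by apply: Alt_nonunique_sylow; rewrite ?cardT.
have [x [px odd_x uniq_x]] := exists_unique_sylow_Sym 'I_n pr_p.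
case: defG => defG; last first.
  case: (unique_sylow_not_redundant _ px _ redG); first by rewrite defG inE.
  by rewrite defG.
(* Uniqueness in the symmetric group passes to the alternating group, where redundancy forbids it,
   so such a [y] is odd. *)
have notAlt (y : {perm 'I_n}) : p.-elt y -> unique_sylow p 'Sym_('I_n)%G y -> odd_perm y.
  move=> py uniq_y; apply: contraT => even_y.
  case: (unique_sylow_not_redundant _ py _ redG); first by rewrite defG Alt_even.
  by apply: unique_sylowS uniq_y; apply: subsetT.
have p2 : p = 2.
  case: (even_prime pr_p) => // odd_p; have := notAlt x px uniq_x.
  have odd_o : odd #[x] by case/p_natP: px => m ->; rewrite oddX odd_p orbT.
  by rewrite (negbTE (odd_order_even_perm odd_o)).
subst p; split=> //; apply/alt_redundant_condE => //; split.
  by rewrite -[in odd _]cardT -odd_x // notAlt.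
rewrite -cardT in n_gt0 * => even_n.
have [y [py <- uniq_y]] := exists_unique_sylow_Sym_even n_gt0 even_n.
exact: notAlt.
Qed.
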